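(* Let $V$ be an irreducible $(\mathfrak g,K)$-module for $G=SU(2,1)$, with coefficients $a_{nm},b_{nm},c_{nm},d_{nm}$ describing the action of $\mathfrak g$ (see the context). Then $V$ is unitary if and only if $$a_{nm}\,d_{n+1,\,m+3}\in(-\infty,0)$$ for all $(n,m)$ such that $V_{nm}$ and $V_{n+1,\,m+3}$ are both $K$-types of $V$, and $$b_{nm}\,c_{n+1,\,m-3}\in(-\infty,0)$$ for all $(n,m)$ such that $V_{nm}$ and $V_{n+1,\,m-3}$ are both $K$-types of $V$.
   Context: $\mathbb N=\{1,2,\dots\}$. $G=SU(2,1)$, $K=S(U(2)\times U(1))$, $\mathfrak g=\mathfrak{sl}(3,\mathbb C)$ is the complexification of the Lie algebra $\mathfrak g_0$ of $G$. With $E_{ij}$ the matrix units: $H_\alpha=E_{11}-E_{22}$, $H_\beta=E_{22}-E_{33}$, $X_\alpha=E_{12}$, $X_\beta=E_{23}$, $X_{\alpha+\beta}=E_{13}$, $Y_\alpha=E_{21}$, $Y_\beta=E_{32}$, $Y_{\alpha+\beta}=E_{31}$. The real Lie algebra $\mathfrak g_0$ has basis $iH_\alpha$, $iH_\beta$, $X_\alpha-Y_\alpha$, $i(X_\alpha+Y_\alpha)$, $X_\beta+Y_\beta$, $i(X_\beta-Y_\beta)$, $X_{\alpha+\beta}+Y_{\alpha+\beta}$, $i(X_{\alpha+\beta}-Y_{\alpha+\beta})$. The complexified Lie algebra of $K$ is $\mathfrak k=\mathfrak{sl}(2,\mathbb C)\oplus\mathbb CZ$, with $\mathfrak{sl}(2,\mathbb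 C)$ spanned by $H_\alpha,X_\alpha,Y_\alpha$ and $Z=H_\alpha+2H_\beta$. For $n\in\mathbb N$, $m\in\mathbb Z$ ($n+m$ odd), $V_{nm}$ denotes the irreducible $K$-module of dimension $n$ on which $Z$ acts by the scalar $m$. Its standard basis $v_{nm}^1,\dots,v_{nm}^n$ satisfies $H_\alpha.v_{nm}^k=(n+1-2k)v_{nm}^k$, $X_\alpha.v_{nm}^k=-(k-1)v_{nm}^{k-1}$, $Y_\alpha.v_{nm}^k=-(n-k)v_{nm}^{k+1}$, with $v_{nm}^0=v_{nm}^{n+1}=0$. For an irreducible $(\mathfrak g,K)$-module $V$, every $K$-type occurs with multiplicity one, and $V|_K=\bigoplus_{(n,m)\in S(V)}V_{nm}$ for some $S(V)\subset\mathbb N\times\mathbb Z$; the $V_{nm}$ with $(n,m)\in S(V)$ are the $K$-types of $V$. The action of $\mathfrak g$ is described by coefficients $a_{nm},b_{nm},c_{nm},d_{nm}\in\mathbb C$ through $$X_{\alpha+\beta}.v_{nm}^k=a_{nm}v_{n+1,m+3}^k+\tfrac{k-1}{n-1}c_{nm}v_{n-1,m+3}^{k-1},\quad X_\beta.v_{nm}^k=-a_{nm}v_{n+1,m+3}^{k+1}+\tfrac{n-k}{n-1}c_{nm}v_{n-1,m+3}^k,$$ $$Y_{\alpha+\beta}.v_{nm}^k=b_{nm}v_{n+1,m-3}^{k+1}+\tfrac{n-k}{n-1}d_{nm}v_{n-1,m-3}^k,\quad Y_\beta.v_{nm}^k=b_{nm}v_{n+1,m-3}^k-\tfrac{k-1}{n-1}d_{nm}v_{n-1,m-3}^{k-1}.$$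 Terms involving vectors of spaces $V_{n'm'}$ that are not $K$-types are zero (omitted); in particular for $n=1$ the terms with denominator $n-1$ are omitted and $c_{1m}=d_{1m}=0$. The products $a_{nm}d_{n+1,m+3}$ and $b_{nm}c_{n+1,m-3}$ do not depend on the choice of the standard bases. A $(\mathfrak g,K)$-module $V$ is unitary if it can be equipped with an inner product $\langle\cdot,\cdot\rangle$ (positive definite Hermitian) such that $(X^*+X).v=0$, i.e. $\langle X.v,w\rangle=-\langle v,X.w\rangle$, for all $X\in\mathfrak g_0$ and $v,w\in V$, and such that $K$ acts by unitary operators. *)

(* Defs.v *)
(* The complex numbers are C = R[i] for an arbitrary R : realType. *)
From HB Require Import structures.
From mathcomp Require Import all_boot all_order all_algebra.
From mathcomp Require Import all_classical all_reals all_analysis.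
From mathcomp Require Import complex.
Set Implicit Arguments.
Unset Strict Implicit.
Unset Printing Implicit Defensive.
Import Order.TTheory GRing.Theory Num.Theory.
Import numFieldNormedType.Exports.
Local Open Scope classical_set_scope.
Local Open Scope ring_scope.

Section LieAlgebra.
Variable R : realType.
Local Notation C := R[i].

(* Indices are shifted by one with respect to the usual E_11, ..., E_33. *)
Local Notation E i j := (delta_mx i j : 'M[C]_3).

Definition H_alpha := E 0 0 - E 1 1.
Definition H_beta := E 1 1 - E 2 2.
Definition X_alpha := E 0 1.
Definition X_beta := E 1 2.
Definition X_alphabeta := E 0 2.
Definition Y_alpha := E 1 0.
Definition Y_beta := E 2 1.
Definition Y_alphabeta := E 2 0.
Definition Z_k := H_alpha + 2 *: H_beta.

Definition sl3 : set 'M[C]_3 := [set X | \tr X = 0].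

Definition su21_basis : seq 'M[C]_3 :=
  [:: 'i *: H_alpha; 'i *: H_beta;
      X_alpha - Y_alpha; 'i *: (X_alpha + Y_alpha);
      X_beta + Y_beta; 'i *: (X_beta - Y_beta);
      X_alphabeta + Y_alphabeta; 'i *: (X_alphabeta - Y_alphabeta)].

Definition su21 : set 'M[C]_3 :=
  [set X | exists r : 'I_8 -> R,
     X = \sum_(j < 8) (r j)%:C%C *: su21_basis`_j].

(* S(U(2) x U(1)), with 'M_(2 + 1) and 'M_3 identified by conversion. *)
Definition Kgrp : set 'M[C]_3 :=
  [set k | exists (A : 'M[C]_2) (z : 'M[C]_1),
     [/\ A \is unitarymx, z \is unitarymx,
         k = block_mx A 0 0 z & \det k = 1]].

(* [gam] is differentiable at 0 with derivative X.  The regular module C^o is C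
   with its norm topology. *)
Definition velocity (gam : R -> 'M[C]_3) (X : 'M[C]_3) : Prop :=
  ((t%:C)%C^-1 *: (gam t - gam 0) : 'M[C^o]_3) @[t --> (0 : R)^']
    --> (X : 'M[C^o]_3).

End LieAlgebra.

Section Modules.
Variables (R : realType) (V : lmodType R[i]).
Local Notation C := R[i].

(* The actions of sl(3, C) and K are given by functions on all 3 x 3 matrices,
   whose values outside sl(3, C) and K are never used. *)
Variables (pi rho : 'M[C]_3 -> {linear V -> V}).

Definition lin_span (s : seq V) : set V :=
  [set y | exists f : 'I_(size s) -> C, y = \sum_(j < size s) f j *: s`_j].

(* V carries no topology: by [gK_finite], everything takes place in
   finite-dimensional K-stable subspaces.  There, continuity and convergence for
   the unique Hausdorff vector space topology amount to continuity and
   convergence of the values of all linear functionals phi (and all functionals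
   on a subspace extend to V).
   [gK_diff] says that the differential at 1 of the action of K is the
   restriction of pi to Lie(K), the velocities of curves in K through 1. *)
Record gK_module : Prop := GKModule {
  gK_linear : forall (t : C) X Y x, sl3 X -> sl3 Y ->
    pi (t *: X + Y) x = t *: pi X x + pi Y x;
  gK_bracket : forall X Y x, sl3 X -> sl3 Y ->
    pi (X *m Y - Y *m X) x = pi X (pi Y x) - pi Y (pi X x);
  gK_1 : forall x, rho 1%:M x = x;
  gK_mul : forall k l x, Kgrp k -> Kgrp l -> rho (k *m l) x = rho k (rho l x);
  gK_Ad : forall k X x, Kgrp k -> sl3 X ->
    rho k (pi X x) = pi (k *m X *m invmx k) (rho k x);
  gK_finite : forall x, exists s : seq V, lin_span s x /\
    forall k y, Kgrp k -> lin_span s y -> lin_span s (rho k y);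
  gK_continuous : forall x (phi : {scalar V}),
    {within [set k : 'M[C^o]_3 | @Kgrp R k],
      continuous (fun k : 'M[C^o]_3 => phi (rho k x) : C^o)};
  gK_diff : forall (gam : R -> 'M[C]_3) X,
    (forall t, Kgrp (gam t)) -> gam 0 = 1%:M -> velocity gam X ->
    forall x (phi : {scalar V}),
      (phi ((t%:C)%C^-1 *: (rho (gam t) x - x)) : C^o) @[t --> (0 : R)^']
        --> (phi (pi X x) : C^o)
}.

Definition gK_submodule (W : set V) : Prop :=
  [/\ W 0,
      forall (t : C) x y, W x -> W y -> W (t *: x + y),
      forall X x, sl3 X -> W x -> W (pi X x) &
      forall k x, Kgrp k -> W x -> W (rho k x)].

Definition gK_irreducible : Prop :=
  (exists x : V, x != 0) /\
  forall W : set V, gK_submodule W -> W = [set 0] \/ W = setT.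

Definition gK_unitary : Prop :=
  exists ip : {dot V for Num.conj},
    (forall X x y, su21 X -> ip (pi X x) y = - ip x (pi X y)) /\
    (forall k x y, Kgrp k -> ip (rho k x) (rho k y) = ip x y).

(* V|_K is the direct sum of the V_nm for (n, m) in S, and v n m 1, ..., v n m n
   is the standard basis of V_nm.  All other values of v are 0, so that terms
   that involve v_nm^0, v_nm^(n+1) or a V_nm that is not a K-type vanish.
   Since K is connected, its action on V_nm is determined by that of k. *)
Record Ktype_decomposition (S : set (nat * int)) (v : nat -> int -> nat -> V)
    : Prop := KtypeDecomposition {
  kt_dom : forall n m, S (n, m) -> (0 < n)%N /\ odd (n + `|m|)%N;
  kt_out : forall n m k, ~ (S (n, m) /\ (1 <= k <= n)%N) -> v n m k = 0;
  kt_span : forall x : V, exists (s : seq (nat * int * nat)) f,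
    x = \sum_(p <- s) (f p : C) *: v p.1.1 p.1.2 p.2;
  kt_free : forall (s : seq (nat * int * nat)) (f : nat * int * nat -> C),
    uniq s ->
    (forall p, p \in s -> S (p.1.1, p.1.2) /\ (1 <= p.2 <= p.1.1)%N) ->
    \sum_(p <- s) f p *: v p.1.1 p.1.2 p.2 = 0 ->
    forall p, p \in s -> f p = 0;
  kt_H : forall n m k, S (n, m) -> (1 <= k <= n)%N ->
    pi (@H_alpha R) (v n m k) = (n%:R + 1 - 2 * k%:R) *: v n m k;
  kt_X : forall n m k, S (n, m) -> (1 <= k <= n)%N ->
    pi (@X_alpha R) (v n m k) = - (k%:R - 1) *: v n m k.-1;
  kt_Y : forall n m k, S (n, m) -> (1 <= k <= n)%N ->
    pi (@Y_alpha R) (v n m k) = - (n%:R - k%:R) *: v n m k.+1;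
  kt_Z : forall n m k, S (n, m) -> (1 <= k <= n)%N ->
    pi (@Z_k R) (v n m k) = m%:~R *: v n m k
}.

(* For n = 1 the fractions are 0 / 0 = 0, and v n.-1 = v 0 vanishes anyway. *)
Record action_coefficients (S : set (nat * int)) (v : nat -> int -> nat -> V)
    (a b c d : nat -> int -> C) : Prop := ActionCoefficients {
  ac_c1 : forall m, c 1%N m = 0;
  ac_d1 : forall m, d 1%N m = 0;
  ac_Xab : forall n m k, S (n, m) -> (1 <= k <= n)%N ->
    pi (@X_alphabeta R) (v n m k) =
      a n m *: v n.+1 (m + 3) k
      + ((k%:R - 1) / (n%:R - 1) * c n m) *: v n.-1 (m + 3) k.-1;
  ac_Xb : forall n m k, S (n, m) -> (1 <= k <= n)%N ->
    pi (@X_beta R) (v n m k) =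
      - a n m *: v n.+1 (m + 3) k.+1
      + ((n%:R - k%:R) / (n%:R - 1) * c n m) *: v n.-1 (m + 3) k;
  ac_Yab : forall n m k, S (n, m) -> (1 <= k <= n)%N ->
    pi (@Y_alphabeta R) (v n m k) =
      b n m *: v n.+1 (m - 3) k.+1
      + ((n%:R - k%:R) / (n%:R - 1) * d n m) *: v n.-1 (m - 3) k;
  ac_Yb : forall n m k, S (n, m) -> (1 <= k <= n)%N ->
    pi (@Y_beta R) (v n m k) =
      b n m *: v n.+1 (m - 3) k
      - ((k%:R - 1) / (n%:R - 1) * d n m) *: v n.-1 (m - 3) k.-1
}.

End Modules.

(* Main.v *)
From HB Require Import structures.
Require Import Defs.
From mathcomp Require Import all_boot all_order all_algebra fingroup perm.
From mathcomp Require Import all_classical all_reals all_analysis.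
From mathcomp Require Import complex.
From mathcomp Require Import zify ring.
Set Implicit Arguments.
Unset Strict Implicit.
Unset Printing Implicit Defensive.
Import Order.TTheory GRing.Theory Num.Theory.
Import numFieldNormedType.Exports.
Local Open Scope classical_set_scope.
Local Open Scope ring_scope.
Local Open Scope sesquilinear_scope.

(** Invariance of a form under su(2,1) is a condition on norms along the edges
    of a planar graph.  Its vertices are the K-types (n, m); an edge from (n, m)
    to (n + 1, m + 3) carries the coefficient a upwards and d downwards, an edge
    from (n, m) to (n + 1, m - 3) carries b upwards and c downwards.  Let tau be
    the conjugate-linear map of sl(3,C) that is - 1 on su(2,1).  A Hermitian
    form B is invariant under su(2,1) exactly when pi (tau X) is adjoint to
    pi X for all X (su21_tau_adjoint, tau_adjoint_su21).  Such a B is determined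
    on V_nm by N(n, m) = B(v_nm^1, v_nm^1) (Ktype_norm), and

      a_nm N(n + 1, m + 3) = - conj(d_{n+1,m+3}) N(n, m),
      b_nm N(n + 1, m - 3) = - conj(c_{n+1,m-3}) N(n, m)

    between neighbouring K-types (Ktype_edge_ad, Ktype_edge_bc).

    Suppose that V is unitary.  As all N(n, m) are positive, the first equation
    says that a_nm d_{n+1,m+3} is a negative multiple of the squared modulus of
    d_{n+1,m+3}, and similarly for the second.  It remains to see that no edge
    between two K-types has the coefficient 0.  The commutators of X_{alpha+beta}
    with X_beta and Y_beta, and of Y_{alpha+beta} with X_beta and Y_beta, are 0
    or lie in k; evaluated at the vectors v_nm^1 they say that in a unit square
    of the graph the two products of coefficients from a corner to the opposite
    one agree up to a nonzero factor (square_ac, square_bd, square_ab,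
    square_cd).  Call an edge good if its coefficients are nonzero.  Two good
    edges that meet in a corner of a unit square then force all vertices of the
    square to be K-types and all its edges to be good (grid_corners_fill).
    Consequently a walk along good edges fills the whole rectangle between its
    end points (full_rect_h, full_rect_v).  By irreducibility such walks lead
    from any K-type to any other (step_closed_full), so the rectangle between
    any two K-types consists of good edges (grid_reached_all); for two
    neighbours this rectangle is the edge that joins them (ad_neq0, bc_neq0).

    Suppose conversely that all products are negative.  The equations above
    prescribe positive ratios of norms along the edges.  By square_ab and
    square_cd the ratios are compatible around each unit square, and since all
    rectangles are full they are the ratios of a positive function N
    (grid_potential, norms_exist).  The form for which the v_nm^k are orthogonal
    with norms N(n, m) divided by binomial coefficients then satisfies the
    adjointness relations (Kform_tau_adjoint).

    It is also invariant under K.  The centre Z and the Casimir operator of k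
    commute with K and separate the K-types, hence K preserves each V_nm
    (Ktype_rho_stable).  Transported by an element of K, the form remains
    invariant under su(2,1), and so on V_nm it is multiplied by a scalar
    (K_scaling).  The powers of this scalar are bounded because K is compact,
    so it is at most 1; applied to the inverse element as well, this shows that
    it is 1 (K_invariant). *)

(** * Full rectangles in the integer grid *)

(** Intervals with 0 as an end point, for u of either sign. *)
Definition between (u x : int) : Prop := 0 <= x <= u \/ u <= x <= 0.

Ltac lia_between := unfold between in *; lia.

(** Two relations on grid points encode an edge set: Eh u w holds for the edge
    from (u, w) to (u + 1, w), and Ev u w for the edge from (u, w) to
    (u, w + 1). *)
Section Grid.
Variables Eh Ev : int -> int -> Prop.

Definition full_square u w :=
  [/\ Eh u w, Eh u (w + 1), Ev u w & Ev (u + 1) w].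

(** The four clauses are the four corners (u, w), (u + 1, w), (u, w + 1) and
    (u + 1, w + 1) of a unit square. *)
Definition corners_fill := forall u w,
  [/\ Eh u w -> Ev u w -> full_square u w,
      Eh u w -> Ev (u + 1) w -> full_square u w,
      Eh u (w + 1) -> Ev u w -> full_square u w &
      Eh u (w + 1) -> Ev (u + 1) w -> full_square u w].

(** The rectangle has the opposite corners (0, 0) and (u, w). *)
Definition full_rect u w :=
  (forall x y, between u x -> between u (x + 1) -> between w y -> Eh x y) /\
  (forall x y, between u x -> between w y -> between w (y + 1) -> Ev x y).

Lemma full_rect0 : full_rect 0 0.
Proof. by rewrite /full_rect; split=> x y *; exfalso; lia_between. Qed.

Lemma full_rect_sub u w u' w' :
  between u u' -> between w w' -> full_rect u w -> full_rect u' w'.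
Proof.
move=> hu hw [Hh Hv].
by split=> x y *; [apply: Hh | apply: Hv]; lia_between.
Qed.

(** A full column u and one edge that leaves it in row w propagate to the column
    u + 1: each unit square of the strip between the two columns shares a corner
    with the part that is already full. *)
Lemma full_strip u w (fill : corners_fill) :
    (forall y, between w y -> between w (y + 1) -> Ev u y) -> Eh u w ->
  (forall y, between w y -> Eh u y) /\
  (forall y, between w y -> between w (y + 1) -> Ev (u + 1) y).
Proof.
move=> Hv Huw.
suff H (k : nat) : (forall y, between w y -> (`|w - y| <= k)%N -> Eh u y) /\
    (forall y, between w y -> between w (y + 1) ->
       (`|w - y| <= k)%N -> (`|w - (y + 1)%R| <= k)%N -> Ev (u + 1) y).
  by split=> y *; [apply: (H `|w|%N).1 | apply: (H `|w|%N).2]; lia_between.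
(* The strip is filled square by square, starting at the edge in row w. *)
elim: k => [|k [IHh IHv]].
  split=> y; last by lia_between.
  by move=> _ hk; have -> : y = w by lia.
have below y : 0 <= w -> between w y -> between w (y + 1) ->
    (`|w - (y + 1)%R| <= k)%N -> full_square u y.
  move=> w0 hy hy1 hk; have [_ _ + _] := fill u y.
  by apply; [apply: IHh | apply: Hv].
have above y : w < 0 -> between w y -> between w (y + 1) ->
    (`|w - y| <= k)%N -> full_square u y.
  move=> w0 hy hy1 hk; have [+ _ _ _] := fill u y.
  by apply; [apply: IHh | apply: Hv].
split=> y hy.
  move=> hk; have [/IHh|hk'] := leqP `|(w - y)%R|%N k; first exact.
  have [w0|w0] := lerP 0 w.
    by have [] : full_square u y by apply: below => //; lia_between.
  rewrite -[y](subrK 1).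
  by have [] : full_square u (y - 1) by apply: above => //; rewrite ?subrK //; lia_between.
move=> hy1 hk hk1; have [w0|w0] := lerP 0 w.
  by have [] : full_square u y by apply: below => //; lia_between.
by have [] : full_square u y by apply: above => //; lia_between.
Qed.

(** For u < 0 the new rectangle lies inside the old one; otherwise a strip is
    added. *)
Lemma full_rect_right u w (fill : corners_fill) :
  full_rect u w -> Eh u w -> full_rect (u + 1) w.
Proof.
move=> [Hh Hv] Huw.
have [u0|u0] := ltrP u 0.
  by apply: (@full_rect_sub u w) => //; lia_between.
have [Sh Sv] : (forall y, between w y -> Eh u y) /\
    (forall y, between w y -> between w (y + 1) -> Ev (u + 1) y).
  by apply: full_strip => // y *; apply: Hv => //; lia_between.
split=> x y.
  have [-> _ _|xu *] := eqVneq x u; first exact: Sh.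
  by apply: Hh; lia_between.
have [-> _|xu *] := eqVneq x (u + 1); first exact: Sv.
by apply: Hv; lia_between.
Qed.

End Grid.

(** Exchanging the axes and reflecting in a vertical line preserve the corner
    condition; they reduce the four directions of a move to a move to the right. *)
Section Symmetries.
Variables Eh Ev : int -> int -> Prop.

Lemma corners_fill_swap : corners_fill Eh Ev ->
  corners_fill (fun u w => Ev w u) (fun u w => Eh w u).
Proof.
by move=> f u w; have [f1 f2 f3 f4] := f w u; split=> a b;
  have [] : full_square Eh Ev w u by first [by apply: f1 | by apply: f2 | by apply: f3 | by apply: f4].
Qed.

Lemma full_rect_swap u w :
  full_rect Eh Ev u w <-> full_rect (fun u w => Ev w u) (fun u w => Eh w u) w u.
Proof. by split=> -[h1 h2]; split=> x y *; (apply: h1 || apply: h2). Qed.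

Let Eh' u w := Eh (- u - 1) w.
Let Ev' u w := Ev (- u) w.

Lemma corners_fill_flip : corners_fill Eh Ev -> corners_fill Eh' Ev'.
Proof.
move=> f u w; have [] := f (- u - 1) w; rewrite /Eh' /Ev' /full_square.
have -> : - u - 1 + 1 = - u by lia.
have -> : - (u + 1) = - u - 1 by lia.
by move=> f1 f2 f3 f4; split=> a b;
  first [by case: f1 | by case: f2 | by case: f3 | by case: f4].
Qed.

Lemma full_rect_flip u w : full_rect Eh Ev u w <-> full_rect Eh' Ev' (- u) w.
Proof.
rewrite /full_rect /Eh' /Ev' /between; split=> -[h1 h2]; split=> x y *.
- by apply: h1; lia.
- by apply: h2; lia.
- by have -> : x = - (- x - 1) - 1; [lia | apply: h1; lia].
- by rewrite -[x]opprK; apply: h2; lia.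
Qed.

End Symmetries.

Section Moves.
Variables Eh Ev : int -> int -> Prop.
Hypothesis fill : corners_fill Eh Ev.

Lemma full_rect_h u w : Eh u w -> full_rect Eh Ev u w <-> full_rect Eh Ev (u + 1) w.
Proof.
move=> Huw; split=> [?|/full_rect_flip r]; first exact: full_rect_right.
apply/full_rect_flip; have -> : - u = - (u + 1) + 1 by lia.
apply: full_rect_right r _; first exact: corners_fill_flip.
by rewrite (_ : - - (u + 1) - 1 = u) //; lia.
Qed.
End Moves.

Lemma full_rect_v Eh Ev (fill : corners_fill Eh Ev) u w :
  Ev u w -> full_rect Eh Ev u w <-> full_rect Eh Ev u (w + 1).
Proof.
move=> Huw; rewrite !(full_rect_swap Eh Ev).
by apply: full_rect_h => //; apply: corners_fill_swap.
Qed.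

(** * Potentials on the integer grid *)
Section Potential.
Variable F : numFieldType.

Lemma line_potential (r : int -> F) : (forall u, 0 < r u) ->
  exists f : int -> F, [/\ f 0 = 1, forall u, 0 < f u
                         & forall u, f (u + 1) = r u * f u].
Proof.
move=> r0; exists (fun u => match u with
  | Posz n => \prod_(i < n) r i%:Z | Negz n => \prod_(i < n.+1) (r (Negz i))^-1 end).
split; first exact: big_ord0.
  by case=> n; apply: prodr_gt0 => i _; rewrite ?invr_gt0.
case=> n; first by rewrite -PoszD addn1 big_ord_recr mulrC.
case: n => [|n]; first by rewrite (_ : Negz 0 + 1 = Posz 0) ?big_ord0 ?big_ord1 ?divff ?gt_eqF //.
rewrite (_ : Negz n.+1 + 1 = Negz n); last by lia.
by rewrite [in RHS]big_ord_recr /= mulrCA divff ?mulr1 ?gt_eqF.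
Qed.

Variables Eh Ev : int -> int -> Prop.
Variables ra rb : int -> int -> F.
Hypothesis ra_gt0 : forall u w, 0 < ra u w.
Hypothesis rb_gt0 : forall u w, 0 < rb u w.
Hypothesis cocycle : forall u w, full_square Eh Ev u w ->
  ra u w * rb (u + 1) w = rb u w * ra u (w + 1).

(** The function is integrated first along row 0, with the ratios ra, and then
    along the columns, with the ratios rb.  Only the ratios ra in the other rows
    have to be checked: the cocycle identity of a full square transfers the
    equation from one of its horizontal edges to the other, and a full rectangle
    connects row w with row 0. *)
Lemma grid_potential : exists p : int -> int -> F,
  [/\ forall u w, 0 < p u w, forall u w, p u (w + 1) = rb u w * p u w
    & forall u w, full_rect Eh Ev u w -> full_rect Eh Ev (u + 1) w ->
        p (u + 1) w = ra u w * p u w].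
Proof.
have [f [f0 fn0 fS]] := line_potential (fun u => ra_gt0 u 0).
have [g gP] := @choice _ _ (fun u g => [/\ g 0 = 1, forall w, 0 < g w
  & forall w, g (w + 1) = rb u w * g w]) (fun u => line_potential (rb_gt0 u)).
exists (fun u w => f u * g u w); split.
- by move=> u w; have [_ gn _] := gP u; rewrite mulr_gt0.
- by move=> u w; have [_ _ gS] := gP u; rewrite gS mulrCA.
move=> u w r1 r2.
have [g0 gn gS] := gP u; have [g0' gn' gS'] := gP (u + 1).
(* The wider of the two rectangles contains the strip between the columns u
   and u + 1. *)
have sq y : between w y -> between w (y + 1) -> full_square Eh Ev u y.
  have [u0|u0] := lerP 0 u.
    by case: r2 => Hh Hv *; split; (apply: Hh || apply: Hv); lia_between.
  by case: r1 => Hh Hv *; split; (apply: Hh || apply: Hv); lia_between.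
have step y : between w y -> between w (y + 1) ->
    (f (u + 1) * g (u + 1) y == ra u y * (f u * g u y)) =
    (f (u + 1) * g (u + 1) (y + 1) == ra u (y + 1) * (f u * g u (y + 1))).
  move=> h h1; have := cocycle (sq y h h1); rewrite gS gS' => e.
  have -> : f (u + 1) * (rb (u + 1) y * g (u + 1) y) =
            rb (u + 1) y * (f (u + 1) * g (u + 1) y) by ring.
  have -> : ra u (y + 1) * (f u * (rb u y * g u y)) =
            rb (u + 1) y * (ra u y * (f u * g u y)).
    have -> : rb (u + 1) y * (ra u y * (f u * g u y)) =
              ra u y * rb (u + 1) y * (f u * g u y) by ring.
    by rewrite e; ring.
  by rewrite (inj_eq (mulfI (lt0r_neq0 (rb_gt0 (u + 1) y)))).
suff H (k : nat) : (forall y, between w y -> (`|y| <= k)%N ->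
    f (u + 1) * g (u + 1) y == ra u y * (f u * g u y)).
  by apply/eqP/(H `|w|%N); lia_between.
elim: k => [y _ hy|k IHk y hy hk].
  by have -> : y = 0 by [lia]; rewrite g0 g0' fS; apply/eqP; ring.
have [y0|y0] := ltrP 0 y.
  by rewrite -[y](subrK 1) -step ?IHk //; lia_between.
have [->|y0'] := eqVneq y 0; first by apply: IHk; lia_between.
by rewrite step ?IHk //; lia_between.
Qed.

End Potential.

(** * Coordinates and diagonal forms *)
Lemma sum_on_support (M : nmodType) (I : eqType) (s t : seq I) (F : I -> M) :
  uniq s -> uniq t -> (forall i, i \in s -> i \notin t -> F i = 0) ->
  (forall i, i \in t -> i \notin s -> F i = 0) ->
  \sum_(i <- s) F i = \sum_(i <- t) F i.
Proof.
move=> us ut st ts.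
rewrite (bigID (mem t)) /= [X in _ + X]big_seq_cond [X in _ + X]big1 ?addr0; last first.
  by move=> i /andP[*]; apply: st.
rewrite [RHS](bigID (mem s)) /= [X in _ = _ + X]big_seq_cond
        [X in _ = _ + X]big1 ?addr0; last by move=> i /andP[*]; apply: ts.
rewrite -big_filter -[RHS]big_filter; apply: perm_big; apply: uniq_perm; rewrite ?filter_uniq //.
by move=> i; rewrite !mem_filter andbC.
Qed.

Section Coordinates.
Variables (C : numClosedFieldType) (V : lmodType C) (I : choiceType).
Variables (e : I -> V) (valid : I -> Prop).
Hypothesis e_out : forall p, ~ valid p -> e p = 0.
Hypothesis e_span : forall x, exists (s : seq I) f, x = \sum_(p <- s) (f p : C) *: e p.
Hypothesis e_free : forall (s : seq I) (f : I -> C), uniq s ->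
  (forall p, p \in s -> valid p) ->
  \sum_(p <- s) f p *: e p = 0 -> forall p, p \in s -> f p = 0.

(** A basis indexed by I minus the indices that are not valid, where e is 0.
    Coordinates are functions of finite support on I. *)
Definition is_coord x (g : I -> C) := exists s : seq I,
  [/\ uniq s, forall p, p \in s -> valid p, forall p, p \notin s -> g p = 0
    & x = \sum_(p <- s) g p *: e p].

Lemma is_coord_widen x g (s t : seq I) : uniq s -> uniq t -> {subset s <= t} ->
  (forall p, p \notin s -> g p = 0) -> x = \sum_(p <- s) g p *: e p ->
  x = \sum_(p <- t) g p *: e p.
Proof.
move=> us ut st g0 ->; apply: sum_on_support => // i.
  by move=> /st ->.
by move=> _ /g0 ->; rewrite scale0r.
Qed.

Lemma is_coord_lin t x y g h : is_coord x g -> is_coord y h ->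
  is_coord (t *: x + y) (fun p => t * g p + h p).
Proof.
move=> [s [us vs g0 xE]] [s' [us' vs' h0 yE]].
exists (undup (s ++ s')); split; first exact: undup_uniq.
- by move=> p; rewrite mem_undup mem_cat => /orP[/vs|/vs'].
- move=> p; rewrite mem_undup mem_cat negb_or => /andP[/g0 -> /h0 ->].
  by rewrite mulr0 addr0.
have -> := is_coord_widen us (undup_uniq (s ++ s')) _ g0 xE.
  have -> := is_coord_widen us' (undup_uniq (s ++ s')) _ h0 yE.
    rewrite scaler_sumr -big_split; apply: eq_bigr => p _ /=.
    by rewrite scalerDl scalerA.
  by move=> p ps; rewrite mem_undup mem_cat ps orbT.
by move=> p ps; rewrite mem_undup mem_cat ps.
Qed.

Lemma is_coord0 : is_coord 0 (fun=> 0).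
Proof. by exists [::]; rewrite big_nil. Qed.

Lemma is_coord_e p : valid p -> is_coord (e p) (fun q => (q == p)%:R).
Proof.
move=> vp; exists [:: p]; split=> //.
- by move=> q; rewrite inE => /eqP ->.
- by move=> q; rewrite inE => /negPf ->.
- by rewrite big_seq1 eqxx scale1r.
Qed.

Lemma is_coord_exists x : exists g, is_coord x g.
Proof.
have [s [f ->]] := e_span x; elim: s => [|p s [g IH]].
  by rewrite big_nil; exists (fun=> 0); apply: is_coord0.
rewrite big_cons; have [vp|nvp] := pselect (valid p).
  by exists (fun q => f p * (q == p)%:R + g q); apply: is_coord_lin => //; apply: is_coord_e.
by rewrite e_out // scaler0 add0r; exists g.
Qed.

Lemma is_coord_unique x g h : is_coord x g -> is_coord x h -> g =1 h.
Proof.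
move=> cg ch p; have := is_coord_lin (-1) cg ch.
rewrite scaleN1r addNr => -[s [us vs gh0 xE]].
have [ps|/gh0] := boolP (p \in s).
  have /eqP := @e_free s _ us vs (esym xE) p ps.
  by rewrite mulN1r addrC subr_eq0 => /eqP.
by move=> /eqP; rewrite mulN1r addrC subr_eq0 => /eqP.
Qed.

Definition coordv (p : I) (x : V) : C := projT1 (cid (is_coord_exists x)) p.

Lemma coordvP x : is_coord x (coordv^~ x).
Proof. exact: projT2 (cid (is_coord_exists x)). Qed.

Lemma coordv_linear p : linear_for *%R (coordv p).
Proof.
by move=> t x y; exact: (is_coord_unique (coordvP _) (is_coord_lin t (coordvP x) (coordvP y)) p).
Qed.

HB.instance Definition _ p := GRing.isLinear.Build C V C *%R (coordv p) (coordv_linear p).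

Lemma coordv_e p q : valid p -> coordv q (e p) = (q == p)%:R.
Proof. by move=> vp; exact: (is_coord_unique (coordvP _) (is_coord_e vp) q). Qed.

Lemma coordv_valid x p : coordv p x != 0 -> valid p.
Proof.
have [s [_ vs c0 _]] := coordvP x; have [/vs //|/c0 ->] := boolP (p \in s).
by rewrite eqxx.
Qed.

Lemma coordv_eq0 x : (forall p, coordv p x = 0) -> x = 0.
Proof.
by move=> c0; have [s [_ _ _ ->]] := coordvP x; rewrite big1 // => p _; rewrite c0 scale0r.
Qed.

Lemma e_neq0 p : valid p -> e p != 0.
Proof.
move=> vp; apply/eqP => e0; have := coordv_e p vp.
by rewrite e0 linear0 eqxx => /eqP; rewrite eq_sym oner_eq0.
Qed.

(** Linear conditions on x need to be tested only on the basis vectors that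
    occur in x. *)
Lemma span_ind (P : V -> Prop) x : P 0 ->
  (forall t y z, P y -> P z -> P (t *: y + z)) ->
  (forall p, valid p -> coordv p x != 0 -> P (e p)) -> P x.
Proof.
move=> P0 Plin Pe; have [s [us vs c0 ->]] := coordvP x.
rewrite big_seq; elim/big_ind: _ => // [y z Py Pz|p ps].
  by rewrite -[y]scale1r; apply: Plin.
have [->|cp] := eqVneq (coordv p x) 0; first by rewrite scale0r.
by rewrite -[_ *: _]addr0; apply: Plin => //; apply: Pe => //; apply: vs.
Qed.

Section DiagonalForm.
Variable N : I -> C.

Definition supp x : seq I := projT1 (cid (coordvP x)).

Lemma suppP x : [/\ uniq (supp x), forall p, p \in supp x -> valid p,
  forall p, p \notin supp x -> coordv p x = 0
  & x = \sum_(p <- supp x) coordv p x *: e p].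
Proof. exact: projT2 (cid (coordvP x)). Qed.

(** The sum runs over some finite support of x; by diag_formE a larger finite
    set of indices gives the same value. *)
Definition diag_form x y := \sum_(p <- supp x) N p * coordv p x * (coordv p y)^*.

Lemma diag_formE (s : seq I) x y : uniq s -> {subset supp x <= s} ->
  diag_form x y = \sum_(p <- s) N p * coordv p x * (coordv p y)^*.
Proof.
have [us vs c0 _] := suppP x => uq sub; apply: sum_on_support => // p.
  by move=> /sub ->.
by move=> _ /c0 ->; rewrite mulr0 mul0r.
Qed.

Lemma diag_form_linear y t x x' :
  diag_form (t *: x + x') y = t * diag_form x y + diag_form x' y.
Proof.
pose s := undup (supp x ++ supp x' ++ supp (t *: x + x')).
have us : uniq s by apply: undup_uniq.
rewrite !(@diag_formE s) //; try by
  move=> p ps; rewrite mem_undup !mem_cat ps ?orbT.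
rewrite mulr_sumr -big_split; apply: eq_bigr => p _ /=.
by rewrite coordv_linear; ring.
Qed.

Hypothesis N_gt0 : forall p, 0 < N p.

Lemma diag_form_herm x y : diag_form x y = (diag_form y x)^*.
Proof.
pose s := undup (supp x ++ supp y).
have us : uniq s by apply: undup_uniq.
rewrite !(@diag_formE s) //; try by
  move=> p ps; rewrite mem_undup !mem_cat ps ?orbT.
rewrite rmorph_sum; apply: eq_bigr => p _ /=.
rewrite !rmorphM /= conjCK (conj_Creal (gtr0_real (N_gt0 p))); ring.
Qed.

Lemma diag_form_pos x : x != 0 -> 0 < diag_form x x.
Proof.
move=> x0; have [us vs c0 xE] := suppP x.
have term_ge0 p : 0 <= N p * coordv p x * (coordv p x)^*.
  by rewrite -mulrA mulr_ge0 ?mul_conjC_ge0 ?ltW.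
rewrite lt0r sumr_ge0 // andbT; apply: contra_neq x0 => d0.
apply: coordv_eq0 => p; have [ps|/c0 //] := boolP (p \in supp x).
move/eqP: d0; rewrite psumr_eq0 // => /allP/(_ p ps) /=.
by rewrite -mulrA mulf_eq0 (gt_eqF (N_gt0 p)) mul_conjC_eq0 => /eqP.
Qed.

Lemma diag_form_e p q : valid p -> valid q -> diag_form (e p) (e q) = N p * (p == q)%:R.
Proof.
move=> vp vq; rewrite (@diag_formE (undup (p :: supp (e p)))) ?undup_uniq //; last first.
  by move=> r rs; rewrite mem_undup inE rs orbT.
rewrite (bigD1_seq p) ?undup_uniq ?mem_undup ?mem_head //= big1 ?addr0.
  by rewrite !coordv_e // eqxx mulr1 conjC_nat.
by move=> r rp; rewrite coordv_e // (negPf rp) mulr0 mul0r.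
Qed.

End DiagonalForm.
End Coordinates.

(** * Hermitian forms *)
Section HermitianForms.
Variables (C : numClosedFieldType) (V : lmodType C).

Definition hermitian_form (B : V -> V -> C) :=
  (forall y t x x', B (t *: x + x') y = t * B x y + B x' y) /\
  (forall x y, B x y = (B y x)^*).

Variable B : V -> V -> C.
Hypothesis hB : hermitian_form B.

Lemma hermZDl t x x' y : B (t *: x + x') y = t * B x y + B x' y.
Proof. exact: hB.1. Qed.

Lemma herm_conj x y : B x y = (B y x)^*. Proof. exact: hB.2. Qed.

Lemma hermZDr t x y y' : B x (t *: y + y') = t^* * B x y + B x y'.
Proof. by rewrite herm_conj hermZDl rmorphD rmorphM [B x y]herm_conj [B x y']herm_conj. Qed.

Lemma herm0l y : B 0 y = 0.
Proof. by have := hermZDl (-1) 0 0 y; rewrite scaler0 addr0 mulN1r addNr. Qed.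

Lemma herm0r x : B x 0 = 0. Proof. by rewrite herm_conj herm0l rmorph0. Qed.

Lemma hermZl t x y : B (t *: x) y = t * B x y.
Proof. by rewrite -[t *: x]addr0 hermZDl herm0l addr0. Qed.

Lemma hermZr t x y : B x (t *: y) = t^* * B x y.
Proof. by rewrite herm_conj hermZl rmorphM [B x y]herm_conj. Qed.

Lemma hermDl x x' y : B (x + x') y = B x y + B x' y.
Proof. by rewrite -[x]scale1r hermZDl mul1r scale1r. Qed.

Lemma hermDr x y y' : B x (y + y') = B x y + B x y'.
Proof. by rewrite herm_conj hermDl rmorphD [B x y]herm_conj [B x y']herm_conj. Qed.

Lemma hermNl x y : B (- x) y = - B x y.
Proof. by rewrite -scaleN1r hermZl mulN1r. Qed.

Lemma hermNr x y : B x (- y) = - B x y.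
Proof. by rewrite herm_conj hermNl rmorphN [B x y]herm_conj. Qed.

Lemma adjoint_sym (f g : V -> V) : (forall x y, B (f x) y = B x (g y)) ->
  forall x y, B (g x) y = B x (f y).
Proof. by move=> fg x y; rewrite herm_conj -fg -herm_conj. Qed.

End HermitianForms.

Lemma exists_dot (C : numClosedFieldType) (V : lmodType C) (f : V -> V -> C) :
  hermitian_form f -> (forall x, x != 0 -> 0 < f x x) ->
  exists ip : {dot V for Num.conj}, forall x y, ip x y = f x y.
Proof.
move=> [flin fherm] fpos.
have flinr x t y y' : f x (t *: y + y') = t^* * f x y + f x y'.
  by rewrite fherm flin rmorphD rmorphM [f x y]fherm [f x y']fherm.
pose bil := @bilinear_isBilinear.Build C V V C *%R (Num.conj \; *%R) f (flin, flinr).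
have hermE x y : f x y = (-1) ^+ false * Num.conj (f y x) by rewrite mul1r.
pose herm := isHermitianSesquilinear.Build C V false Num.conj f hermE.
pose dot := isDotProduct.Build C V f fpos.
pose ip : {dot V for Num.conj} := HB.pack f bil herm dot.
by exists ip.
Qed.

Lemma dot_hermitian (C : numClosedFieldType) (V : lmodType C) (ip : {dot V for Num.conj}) :
  hermitian_form (fun x y => ip x y).
Proof.
split=> [y t x x'|x y]; first by rewrite linearDl linearZl.
by rewrite hermitian_subproof expr0 mul1r.
Qed.

(** * Compactness of K *)
Section Compactness.
Variable R : realType.
Local Notation C := R[i].

Lemma gt0_complexE (e : C) : 0 < e -> e = (complex.Re e)%:C%C /\ 0 < complex.Re e.
Proof. by case: e => x y; rewrite ltcE /= => /andP[/eqP -> ?]. Qed.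

Lemma continuous_pair_to_complex :
  continuous (fun p : R * R => (p.1 +i* p.2)%C : C^o).
Proof.
move=> p A /nbhs_ballP[e /= e0 eA].
have [eE re0] := gt0_complexE e0.
apply/nbhs_ballP; exists (complex.Re e / 2); first by rewrite /= divr_gt0.
move=> q [/= h1 h2]; apply: eA.
rewrite -ball_normE /= in h1 h2 *.
have E : (p.1 +i* p.2)%C - (q.1 +i* q.2)%C =
   (p.1 - q.1)%:C%C + (0 +i* (p.2 - q.2))%C :> C by simpc.
change (`|(p.1 +i* p.2)%C - (q.1 +i* q.2)%C : C| < e); rewrite E.
apply: le_lt_trans (ler_normD _ _) _.
rewrite !normc_def /= !expr0n /= addr0 add0r !sqrtr_sqr eE -rmorphD ltcR.
by rewrite [X in _ < X](splitr (complex.Re e)); apply: ltrD.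
Qed.

Lemma continuous_conj : continuous (Num.conj : C^o -> C^o).
Proof.
move=> x A /nbhs_ballP[e /= e0 eA].
apply/nbhs_ballP; exists e => // y; rewrite -ball_normE /= => xy; apply: eA.
by rewrite -ball_normE /= -rmorphB norm_conjC.
Qed.

(** Compactness of a segment is known over the reals; the complex unit square
    is the image of a product of two segments. *)
Lemma compact_unit_square : compact ((fun p : R * R => (p.1 +i* p.2)%C : C^o) @`
  (`[-1, 1] `*` `[-1, 1])).
Proof.
apply: continuous_compact; first exact/continuous_subspaceT/continuous_pair_to_complex.
by apply: compact_setX; apply: segment_compact.
Qed.

Lemma continuous_vec_mx m n :
  continuous (vec_mx : 'rV[C^o]_(m * n) -> 'M[C^o]_(m, n)).
Proof.
move=> x A /nbhs_ballP[e /= e0 eA].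
apply/nbhs_ballP; exists e => // y [_ xy]; apply: eA; split=> // i j.
by rewrite !mxE; apply: xy.
Qed.

(** Matrices are read as row vectors, to which Tychonoff's theorem for a power
    of the unit square applies. *)
Lemma compact_bounded_entries m n : exists2 B : set 'M[C^o]_(m, n), compact B &
  forall M : 'M[C]_(m, n), (forall i j, `|M i j| <= 1) -> B M.
Proof.
eexists; first apply: continuous_compact.
- exact/continuous_subspaceT/(@continuous_vec_mx m n).
- exact: (@rV_compact _ _ (fun=> _) (fun=> compact_unit_square)).
move=> M M1; exists (mxvec M); last by rewrite mxvecK.
move=> i; case/mxvec_indexP: i => i j; rewrite mxvecE.
have := M1 i j; case: (M i j) => x y; rewrite normc_def lecR => h.
exists (x, y) => //=.
have sq : Num.sqrt (x ^+ 2 + y ^+ 2) ^+ 2 <= 1 by rewrite expr_le1 ?sqrtr_ge0.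
rewrite sqr_sqrtr ?addr_ge0 ?sqr_ge0 //= in sq.
split; rewrite /= in_itv /= -ler_norml -(@expr_le1 _ 2) // real_normK ?num_real //.
  by apply: le_trans sq; rewrite lerDl sqr_ge0.
by apply: le_trans sq; rewrite lerDr sqr_ge0.
Qed.

End Compactness.

Section CompactGroup.
Variable R : realType.
Local Notation C := R[i].
Implicit Types k l : 'M[C]_3.

(** The condition says that k is block diagonal, with blocks of size 2 and 1. *)
Definition blockwise k := forall i j : 'I_3, (i == ord_max) != (j == ord_max) -> k i j = 0.

Lemma block_unitary (A : 'M[C]_2) (z : 'M[C]_1) :
  (block_mx A 0 0 z : 'M[C]_(2 + 1)) *m (block_mx A 0 0 z) ^t* =
  block_mx (A *m A ^t*) 0 0 (z *m z ^t*).
Proof.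
rewrite tr_block_mx map_block_mx mulmx_block !trmx0 !map_mx0.
by rewrite !mulmx0 !mul0mx !addr0 !add0r.
Qed.

(** Equations on the entries of k, from which K is seen to be closed, and to be
    a group. *)
Lemma KgrpP k : Kgrp k <-> [/\ k *m k ^t* = 1%:M, blockwise k & \det k = 1].
Proof.
split=> [[A [z [/unitarymxP uA /unitarymxP uz -> dk]]]|[uk bk dk]].
  split=> //.
    by rewrite [LHS]block_unitary uA uz; apply/esym/(@scalar_mx_block _ 2 1).
  move=> i j.
  case: (@split_ordP 2 1 i) => i' ->; case: (@split_ordP 2 1 j) => j' ->.
  - by rewrite -!val_eqE /= !ltn_eqF.
  - by move=> _; rewrite [LHS]block_mxEur mxE.
  - by move=> _; rewrite [LHS]block_mxEdl mxE.
  - by rewrite -!val_eqE /= !ord1.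
pose k' : 'M[C]_(2 + 1) := k.
have kE : k' = block_mx (ulsubmx k') 0 0 (drsubmx k').
  rewrite -{1}(@submxK _ 2 1 2 1 k'); congr block_mx.
    by apply/matrixP=> i j; rewrite !mxE; apply: bk; rewrite -!val_eqE /= !ord1 ltn_eqF.
  by apply/matrixP=> i j; rewrite !mxE; apply: bk; rewrite -!val_eqE /= !ord1 (@ltn_eqF j 2).
exists (ulsubmx k'), (drsubmx k'); split => //.
  apply/unitarymxP.
  have := congr1 (fun M : 'M[C]_3 => @ulsubmx _ 2 1 2 1 M) uk.
  by rewrite (kE : k = _) [X in ulsubmx X]block_unitary (@scalar_mx_block _ 2 1) !block_mxKul.
apply/unitarymxP.
have := congr1 (fun M : 'M[C]_3 => @drsubmx _ 2 1 2 1 M) uk.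
by rewrite (kE : k = _) [X in drsubmx X]block_unitary (@scalar_mx_block _ 2 1) !block_mxKdr.
Qed.

Lemma Kgrp_unit k : Kgrp k -> k \in unitmx.
Proof. by move=> /KgrpP[_ _ dk]; rewrite unitmxE dk unitr1. Qed.

Lemma Kgrp_inv k : Kgrp k -> invmx k = k ^t*.
Proof.
move=> Kk; have [uk _ _] := (KgrpP k).1 Kk.
by have := mulKmx (Kgrp_unit Kk) (k ^t* ); rewrite uk mulmx1.
Qed.

Lemma Kgrp1 : Kgrp (1%:M : 'M[C]_3).
Proof.
apply/KgrpP; rewrite trmx1 map_mx1 mulmx1 det1; split=> // i j ij.
by rewrite mxE; case: (eqVneq i j) ij => // ->; rewrite eqxx.
Qed.

Lemma KgrpV k : Kgrp k -> Kgrp (invmx k).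
Proof.
move=> Kk; have [uk bk dk] := (KgrpP k).1 Kk; apply/KgrpP; split.
- rewrite {2}Kgrp_inv // map_trmx trmxK map_mxCK.
  exact: mulVmx (Kgrp_unit Kk).
- by move=> i j ij; rewrite Kgrp_inv // !mxE bk ?conjC0 // eq_sym.
- by rewrite det_inv dk invr1.
Qed.

Lemma blockwiseM k l : blockwise k -> blockwise l -> blockwise (k *m l).
Proof.
move=> bk bl i j ij; rewrite mxE big1 // => s _.
have [is_|is_] := eqVneq (i == ord_max) (s == ord_max).
  by rewrite bl ?mulr0 // -is_.
by rewrite bk ?mul0r.
Qed.

Lemma KgrpM k l : Kgrp k -> Kgrp l -> Kgrp (k *m l).
Proof.
move=> /KgrpP[uk bk dk] /KgrpP[ul bl dl]; apply/KgrpP; split.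
- by rewrite trmx_mul map_mxM mulmxA -[k *m l *m _]mulmxA ul mulmx1.
- exact: blockwiseM.
- by rewrite det_mulmx dk dl mulr1.
Qed.

Lemma Kgrp_entry_le1 k i j : Kgrp k -> `|k i j| <= 1.
Proof.
move=> /KgrpP[uk _ _].
have := congr1 (fun M : 'M[C]_3 => M i i) uk; rewrite !mxE eqxx (bigD1 j) //= => s1.
rewrite -(@expr_le1 _ 2) // normCK -[leRHS]s1 !mxE lerDl.
by apply: sumr_ge0 => l _; rewrite !mxE mul_conjC_ge0.
Qed.

Lemma continuous_entry i j : continuous ((fun k => k i j) : 'M[C^o]_3 -> C^o).
Proof. exact: (@coord_continuous C 3 3 i j). Qed.

(** K is cut out by polynomial equations in the entries of k and their
    conjugates. *)
Lemma closed_Kgrp : closed [set k : 'M[C^o]_3 | @Kgrp R k].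
Proof.
have closed1 (c : C^o) : closed [set x : C^o | x = c].
  exact/accessible_closed_set1/hausdorff_accessible/norm_hausdorff.
have closed_level (f : 'M[C^o]_3 -> C^o) c : continuous f -> closed [set k | f k = c].
  by move=> /continuous_closedP/(_ _ (closed1 c)).
have cont_mul (f g : 'M[C^o]_3 -> C^o) : continuous f -> continuous g ->
    continuous ((fun k => f k * g k) : 'M[C^o]_3 -> C^o).
  by move=> fc gc k; apply: (@continuousM C _ f g k (fc k) (gc k)).
have cont_sum (I : finType) (f : I -> 'M[C^o]_3 -> C^o) :
    (forall i, continuous (f i)) -> continuous ((fun k => \sum_i f i k) : 'M[C^o]_3 -> C^o).
  by move=> fc; apply: continuous_big => //; apply: add_continuous.
have cont_prod (I : finType) (f : I -> 'M[C^o]_3 -> C^o) :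
    (forall i, continuous (f i)) -> continuous ((fun k => \prod_i f i k) : 'M[C^o]_3 -> C^o).
  by move=> fc; apply: continuous_big => //; apply: mul_continuous.
rewrite (_ : mkset _ =
   (\bigcap_(p in [set: 'I_3 * 'I_3])
     [set k : 'M[C^o]_3 | \sum_j k p.1 j * (k p.2 j)^* = (p.1 == p.2)%:R]) `&`
   (\bigcap_(p in [set p : 'I_3 * 'I_3 | (p.1 == ord_max) != (p.2 == ord_max)])
     [set k : 'M[C^o]_3 | k p.1 p.2 = 0]) `&`
   [set k : 'M[C^o]_3 | \det (k : 'M[C]_3) = 1]).
  apply: closedI; first apply: closedI.
  - apply: closed_bigI => p _.
    apply: closed_level.
    apply: (cont_sum _ (fun j k => k p.1 j * (k p.2 j)^*)) => j.
    apply: (cont_mul (fun k => k p.1 j) (fun k => (k p.2 j)^*)).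
      exact: continuous_entry.
    by move=> k; apply: (@continuous_comp _ _ _ ((fun k => k p.2 j) : 'M[C^o]_3 -> C^o) Num.conj);
      [exact: continuous_entry | exact: continuous_conj].
  - apply: closed_bigI => p _.
    by apply: closed_level; apply: continuous_entry.
  - apply: (closed_level (fun k : 'M[C^o]_3 => \sum_(s : 'S_3) (-1) ^+ s * \prod_i k i (s i))).
    apply: (cont_sum _ (fun (s : 'S_3) k => (-1) ^+ odd_perm s * \prod_i k i (s i))) => s.
    apply: (cont_mul (fun=> (-1) ^+ odd_perm s) (fun k => \prod_i k i (s i))).
      exact: cst_continuous.
    by apply: (cont_prod _ (fun i k => k i (s i))) => i; apply: continuous_entry.
apply/seteqP; split=> k /=.
  move=> /KgrpP[uk bk dk]; split=> //; split; last by move=> [i j] /= /bk.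
  move=> [i j] _ /=; have := congr1 (fun M : 'M[C]_3 => M i j) uk.
  by rewrite !mxE => <-; apply: eq_bigr => l _; rewrite !mxE.
move=> [[uk bk] dk]; apply/KgrpP; split=> //.
  apply/matrixP=> i j; rewrite mxE mxE -(uk (i, j) I).
  by apply: eq_bigr => l _; rewrite !mxE.
by move=> i j ij; apply: (bk (i, j)).
Qed.

Lemma compact_Kgrp : compact [set k : 'M[C^o]_3 | @Kgrp R k].
Proof.
have [B Bc BP] := @compact_bounded_entries R 3 3.
by apply: subclosed_compact closed_Kgrp Bc _ => k Kk; apply: BP => i j; apply: Kgrp_entry_le1.
Qed.

Lemma normRe (z : C) : `|z| = (complex.Re `|z|)%:C%C.
Proof. by rewrite normc_def. Qed.

Lemma continuous_norm_Re : continuous (fun z : C^o => complex.Re `|z : C| : R^o).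
Proof.
move=> x A /nbhs_ballP[e /= e0 eA].
apply/nbhs_ballP; exists e%:C%C; first by rewrite /= ltcR.
move=> y xy; apply: eA; rewrite -ball_normE /= in xy *.
have {}xy : `|(x : C) - y| < e%:C%C by [].
suff : (Num.norm (complex.Re `|x : C| - complex.Re `|y : C|) : R)%:C%C < e%:C%C by rewrite ltcR.
apply: le_lt_trans xy.
have := lerB_dist (x : C) y; have := lerB_dist (y : C) x; rewrite (distrC (y : C)).
rewrite [`|x : C|]normRe [`|y : C|]normRe [`|(x : C) - y|]normRe -!rmorphB !lecR.
by move=> h1 h2; rewrite ler_norml h2 lerNl opprB h1.
Qed.

Lemma bounded_on_Kgrp (f : 'M[C]_3 -> C) :
  {within [set k : 'M[C^o]_3 | @Kgrp R k], continuous (f : 'M[C^o]_3 -> C^o)} ->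
  exists M : C, forall k, Kgrp k -> `|f k| <= M.
Proof.
move=> fc; have fK := continuous_compact fc compact_Kgrp.
have := continuous_compact (continuous_subspaceT continuous_norm_Re) fK.
move=> /(@compact_bounded R R^o) [M [_ MP]]; exists (M + 1)%:C%C => k Kk.
rewrite normRe lecR; apply: le_trans (ler_norm _) _.
by apply: (MP (M + 1)); [rewrite ltrDl | exists (f k) => //; exists k].
Qed.
End CompactGroup.

(** * The involution that defines su(2,1) *)
Section Algebra.
Variable R : realType.
Local Notation C := R[i].
Local Notation E i j := (delta_mx i j : 'M[C]_3).

(** The Gram matrix of the Hermitian form of signature (2, 1) on C^3. *)
Definition signature_mx : 'M[C]_3 := \matrix_(i, j) ((-1) ^+ (i == ord_max) * (i == j)%:R).

(** The adjoint of X with respect to that Hermitian form, so that tau = - 1 on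
    su(2,1). *)
Definition tau (X : 'M[C]_3) : 'M[C]_3 := signature_mx *m X ^t* *m signature_mx.

Lemma tauE X i j : tau X i j = (-1) ^+ (i == ord_max) * (-1) ^+ (j == ord_max) * (X j i)^*.
Proof.
rewrite mxE (bigD1 j) //= big1 => [|l lj]; last first.
  by rewrite [signature_mx l j]mxE (negPf lj) mulr0 mulr0.
rewrite addr0 mxE (bigD1 i) //= big1 => [|l li]; last first.
  by rewrite [signature_mx i l]mxE (eq_sym i l) (negPf li) mulr0 mul0r.
by rewrite !mxE !eqxx !mulr1 addr0 mulrAC.
Qed.

Lemma tau_linear t X Y : tau (t *: X + Y) = t^* *: tau X + tau Y.
Proof.
apply/matrixP=> i j; rewrite tauE 4!mxE !tauE rmorphD rmorphM /= mulrDr.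
by rewrite mulrCA.
Qed.

Lemma tauK : involutive tau.
Proof.
move=> X; apply/matrixP=> i j; rewrite !tauE !rmorphM /= !rmorph_sign conjCK.
by case: (i == _); case: (j == _); rewrite /= ?expr0 ?expr1; ring.
Qed.

(** K consists of isometries of the Hermitian form: it is unitary and commutes
    with the Gram matrix. *)
Lemma tau_conj k X : Kgrp k -> tau (k *m X *m invmx k) = k *m tau X *m invmx k.
Proof.
move=> Kk; have [_ bk _] := (KgrpP k).1 Kk.
have Jk : signature_mx *m k = k *m signature_mx.
  apply/matrixP=> i j; rewrite mxE (bigD1 i) //= big1 => [|l li]; last first.
    by rewrite !mxE (eq_sym i l) (negPf li) mulr0 mul0r.
  rewrite [RHS]mxE (bigD1 j) //= big1 => [|l lj]; last first.
    by rewrite !mxE (negPf lj) !mulr0.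
  rewrite !mxE !eqxx !addr0 !mulr1 mulrC.
  have [->//|ij] := eqVneq (i == ord_max) (j == ord_max).
  by rewrite bk // !mul0r.
have Jk' : k ^t* *m signature_mx = signature_mx *m k ^t*.
  rewrite -Kgrp_inv //; apply: (can_inj (mulKmx (Kgrp_unit Kk))).
  rewrite [LHS]mulmxA mulmxV ?Kgrp_unit // mul1mx [RHS]mulmxA -Jk.
  by rewrite -mulmxA mulmxV ?Kgrp_unit // mulmx1.
rewrite /tau !trmx_mul !map_mxM /= Kgrp_inv // map_trmx trmxK map_mxCK.
by rewrite !mulmxA Jk -!mulmxA Jk'.
Qed.

Lemma sl3_linear t (X Y : 'M[C]_3) : sl3 X -> sl3 Y -> sl3 (t *: X + Y).
Proof. by rewrite /sl3 /= => trX trY; rewrite mxtraceD mxtraceZ trX trY mulr0 addr0. Qed.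

Lemma sl3_conj (k X : 'M[C]_3) : k \in unitmx -> sl3 X -> sl3 (k *m X *m invmx k).
Proof.
by rewrite /sl3 /= => uk trX; rewrite -mulmxA mxtrace_mulC mulmxKV.
Qed.

Lemma sl3_offdiag (i j : 'I_3) : i != j -> sl3 (E i j).
Proof.
move=> ij; rewrite /sl3 /= /mxtrace big1 // => l _; rewrite mxE.
by have [->|] := eqVneq l i; rewrite ?(negPf ij).
Qed.

Lemma sl3_diag (i j : 'I_3) : sl3 (E i i - E j j).
Proof.
have tr1 l : \tr (E l l) = 1.
  by rewrite /mxtrace (bigD1 l) //= big1 ?mxE ?eqxx ?addr0 // => h hl; rewrite mxE (negPf hl).
by rewrite /sl3 /= linearB /= !tr1 subrr.
Qed.

Lemma sl3_Ha : sl3 (@H_alpha R). Proof. exact: sl3_diag. Qed.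
Lemma sl3_Hb : sl3 (@H_beta R). Proof. exact: sl3_diag. Qed.
Lemma sl3_Xa : sl3 (@X_alpha R). Proof. exact: sl3_offdiag. Qed.
Lemma sl3_Xb : sl3 (@X_beta R). Proof. exact: sl3_offdiag. Qed.
Lemma sl3_Xab : sl3 (@X_alphabeta R). Proof. exact: sl3_offdiag. Qed.
Lemma sl3_Ya : sl3 (@Y_alpha R). Proof. exact: sl3_offdiag. Qed.
Lemma sl3_Yb : sl3 (@Y_beta R). Proof. exact: sl3_offdiag. Qed.
Lemma sl3_Yab : sl3 (@Y_alphabeta R). Proof. exact: sl3_offdiag. Qed.
Lemma sl3_Z : sl3 (@Z_k R).
Proof. by rewrite /Z_k addrC; apply: sl3_linear; [apply: sl3_Hb | apply: sl3_Ha]. Qed.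

(** Z is used in place of H_beta because it acts on K-types by scalars. *)
Lemma sl3_ind (P : 'M[C]_3 -> Prop) :
  (forall t X Y, sl3 X -> sl3 Y -> P X -> P Y -> P (t *: X + Y)) ->
  P (@H_alpha R) -> P (@Z_k R) -> P (@X_alpha R) -> P (@X_beta R) ->
  P (@X_alphabeta R) -> P (@Y_alpha R) -> P (@Y_beta R) -> P (@Y_alphabeta R) ->
  forall X, sl3 X -> P X.
Proof.
move=> Plin pH pZ pXa pXb pXab pYa pYb pYab X.
have lin t A B : sl3 A /\ P A -> sl3 B /\ P B -> sl3 (t *: A + B) /\ P (t *: A + B).
  by move=> [sA pA] [sB pB]; split; [apply: sl3_linear | apply: Plin].
have P0 : sl3 (0 : 'M[C]_3) /\ P 0.
  by rewrite -(addNr (@H_alpha R)) -scaleN1r; apply: lin; split=> //; apply: sl3_Ha.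
move=> sX.
have gen t A B : sl3 A -> P A -> sl3 B /\ P B -> sl3 (t *: A + B) /\ P (t *: A + B).
  by move=> sA pA; apply: lin.
have X22 : X 2 2 = - (X 0 0 + X 1 1).
  apply/eqP; rewrite -addr_eq0 addrC -[X in _ == X]sX; apply/eqP.
  rewrite /mxtrace !big_ord_recl big_ord0 addr0 addrA.
  by congr (_ + _ + _); congr (X _ _); apply: val_inj.
have XE : X = ((X 0 0 - X 1 1) / 2) *: @H_alpha R + (((X 0 0 + X 1 1) / 2) *: @Z_k R +
  (X 0 1 *: @X_alpha R + (X 1 2 *: @X_beta R + (X 0 2 *: @X_alphabeta R +
  (X 1 0 *: @Y_alpha R + (X 2 1 *: @Y_beta R + (X 2 0 *: @Y_alphabeta R + 0))))))).
  have e0 (h : (0 < 3)%N) : Ordinal h = 0 :> 'I_3 by apply/eqP.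
  have e1 (h : (1 < 3)%N) : Ordinal h = 1 :> 'I_3 by apply/eqP.
  have e2 (h : (2 < 3)%N) : Ordinal h = 2 :> 'I_3 by apply/eqP.
  apply/matrixP=> i j.
  case: i => [[|[|[|//]]] hi]; case: j => [[|[|[|//]]] hj];
    rewrite !mxE /= ?mulr0n ?mulr1n ?e0 ?e1 ?e2 ?X22; by field.
suff : sl3 X /\ P X by case.
rewrite XE; apply: (gen _ _ _ sl3_Ha pH); apply: (gen _ _ _ sl3_Z pZ).
apply: (gen _ _ _ sl3_Xa pXa); apply: (gen _ _ _ sl3_Xb pXb); apply: (gen _ _ _ sl3_Xab pXab).
apply: (gen _ _ _ sl3_Ya pYa); apply: (gen _ _ _ sl3_Yb pYb); apply: (gen _ _ _ sl3_Yab pYab).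
exact: P0.
Qed.

Lemma comm_Xab_Xb : @X_alphabeta R *m @X_beta R - @X_beta R *m @X_alphabeta R = 0.
Proof. by rewrite /X_alphabeta /X_beta !mul_delta_mx_cond subrr. Qed.

Lemma comm_Yab_Yb : @Y_alphabeta R *m @Y_beta R - @Y_beta R *m @Y_alphabeta R = 0.
Proof. by rewrite /Y_alphabeta /Y_beta !mul_delta_mx_cond subrr. Qed.

Lemma comm_Xab_Yb : @X_alphabeta R *m @Y_beta R - @Y_beta R *m @X_alphabeta R = @X_alpha R.
Proof. by rewrite /X_alphabeta /Y_beta !mul_delta_mx_cond subr0. Qed.

Lemma comm_Xb_Yab : @X_beta R *m @Y_alphabeta R - @Y_alphabeta R *m @X_beta R = @Y_alpha R.
Proof. by rewrite /X_beta /Y_alphabeta !mul_delta_mx_cond subr0. Qed.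

End Algebra.

Section Tau.
Variable R : realType.
Local Notation C := R[i].
Local Notation E i j := (delta_mx i j : 'M[C]_3).

Lemma tau_delta i j :
  tau (E i j) = ((-1) ^+ (i == ord_max) * (-1) ^+ (j == ord_max)) *: E j i.
Proof.
apply/matrixP=> s t; rewrite tauE !mxE conjC_nat.
have [->|sj] := eqVneq s j; have [->|ti] := eqVneq t i;
  by rewrite /= ?mulr0 ?mulr1 // mulrC.
Qed.

Implicit Types X Y : 'M[C]_3.

Lemma tauD X Y : tau (X + Y) = tau X + tau Y.
Proof. by rewrite -[X]scale1r tau_linear rmorph1 !scale1r. Qed.

Lemma tau0 : tau (0 : 'M[C]_3) = 0.
Proof. by apply/matrixP=> i j; rewrite tauE !mxE conjC0 mulr0. Qed.

Lemma tauZ t X : tau (t *: X) = t^* *: tau X.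
Proof. by rewrite -[t *: X]addr0 tau_linear tau0 addr0. Qed.

Lemma tauN X : tau (- X) = - tau X.
Proof. by rewrite -scaleN1r tauZ rmorphN1 scaleN1r. Qed.

Lemma sl3_tau X : sl3 X -> sl3 (tau X).
Proof.
rewrite /sl3 /= => trX.
have -> : \tr (tau X) = (\tr X)^*; last by rewrite trX conjC0.
rewrite /mxtrace rmorph_sum; apply: eq_bigr => i _ /=.
by rewrite tauE; case: (i == _); rewrite ?expr0 ?expr1 ?mulrNN ?mul1r.
Qed.

Lemma tau_Xa : tau (@X_alpha R) = @Y_alpha R.
Proof. by rewrite tau_delta mulr1 scale1r. Qed.
Lemma tau_Xb : tau (@X_beta R) = - @Y_beta R.
Proof. by rewrite tau_delta mul1r scaleN1r. Qed.
Lemma tau_Xab : tau (@X_alphabeta R) = - @Y_alphabeta R.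
Proof. by rewrite tau_delta mul1r scaleN1r. Qed.
Lemma tau_Ya : tau (@Y_alpha R) = @X_alpha R.
Proof. by rewrite -tau_Xa tauK. Qed.
Lemma tau_Yb : tau (@Y_beta R) = - @X_beta R.
Proof. by rewrite -[@Y_beta R]opprK -tau_Xb tauN tauK. Qed.
Lemma tau_Yab : tau (@Y_alphabeta R) = - @X_alphabeta R.
Proof. by rewrite -[@Y_alphabeta R]opprK -tau_Xab tauN tauK. Qed.
Lemma tau_Ha : tau (@H_alpha R) = @H_alpha R.
Proof. by rewrite /H_alpha tauD tauN !tau_delta mulr1 !scale1r. Qed.
Lemma tau_Hb : tau (@H_beta R) = @H_beta R.
Proof. by rewrite /H_beta tauD tauN !tau_delta mulrNN !mulr1 !scale1r. Qed.
Lemma tau_Z : tau (@Z_k R) = @Z_k R.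
Proof. by rewrite /Z_k tauD tauZ tau_Ha tau_Hb conjC_nat. Qed.

Lemma conj_real_complex (r : R) : (r%:C%C : C)^* = r%:C%C.
Proof. by apply/CrealP; rewrite complex_real. Qed.

(** The real form of sl(3,C) defined by tau, which contains the given basis of
    su(2,1). *)
Definition skew X := sl3 X /\ tau X = - X.

Lemma skew_selfadjoint X : sl3 X -> tau X = X -> skew ('i *: X).
Proof.
move=> sX tX; split; last by rewrite tauZ tX conjCi scaleNr.
by rewrite /sl3 /= mxtraceZ sX mulr0.
Qed.

Lemma skew_pair X Y : sl3 X -> sl3 Y -> tau X = Y -> skew (X - Y) /\ skew ('i *: (X + Y)).
Proof.
move=> sX sY tX; have tY : tau Y = X by rewrite -tX tauK.
split; last first.
  by apply: skew_selfadjoint; rewrite ?tauD ?tX ?tY 1?addrC // /sl3 /= mxtraceD sX sY addr0.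
split; last by rewrite tauD tauN tX tY opprB addrC.
by rewrite /sl3 /= mxtraceD -scaleN1r mxtraceZ sX sY mulr0 addr0.
Qed.

Lemma skew_pairN X Y : sl3 X -> sl3 Y -> tau X = - Y -> skew (X + Y) /\ skew ('i *: (X - Y)).
Proof.
move=> sX sY tX; have sY' : sl3 (- Y) by rewrite /sl3 /= -scaleN1r mxtraceZ sY mulr0.
by have := skew_pair sX sY' tX; rewrite opprK.
Qed.

Lemma su21_basis_skew (j : 'I_8) : skew (su21_basis R)`_j.
Proof.
have [a1 a2] := skew_pair (sl3_Xa R) (sl3_Ya R) tau_Xa.
have [b1 b2] := skew_pairN (sl3_Xb R) (sl3_Yb R) tau_Xb.
have [c1 c2] := skew_pairN (sl3_Xab R) (sl3_Yab R) tau_Xab.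
have h1 := skew_selfadjoint (sl3_Ha R) tau_Ha.
have h2 := skew_selfadjoint (sl3_Hb R) tau_Hb.
case: j => [[|[|[|[|[|[|[|[|//]]]]]]]] hj]; [exact: h1 | exact: h2 | exact: a1
  | exact: a2 | exact: b1 | exact: b2 | exact: c1 | exact: c2].
Qed.

Lemma su21_skew X : su21 X -> skew X.
Proof.
move=> [r ->]; elim/big_ind: _ => [|Y Y' [sY tY] [sY' tY']|j _].
- by split; [apply: mxtrace0 | rewrite tau0 oppr0].
- by split; [rewrite /sl3 /= mxtraceD sY sY' addr0 | rewrite tauD tY tY' opprD].
have [sj tj] := su21_basis_skew j; split.
  by rewrite /sl3 /= mxtraceZ sj mulr0.
by rewrite tauZ conj_real_complex tj scalerN.
Qed.

Lemma su21_basis_mem (j : 'I_8) : su21 (su21_basis R)`_j.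
Proof.
exists (fun i => (i == j)%:R); rewrite (bigD1 j) //= big1 ?addr0 => [|i /negPf ->].
  by rewrite eqxx scale1r.
by rewrite scale0r.
Qed.

End Tau.

(** * Casimir operators *)

(** The quadratic operator sum_ij P_ij P_ji is the Casimir element of gl(n).
    If r transforms the matrix (P_ij) by conjugation with k, the products
    k k' = 1 cancel in it. *)
Lemma casimir_invariant (F : comUnitRingType) (V : lmodType F) n
    (P : 'I_n -> 'I_n -> {linear V -> V}) (r : {linear V -> V}) (k k' : 'M[F]_n) :
  k *m k' = 1%:M ->
  (forall i j x, r (P i j x) = \sum_a \sum_b (k a i * k' j b) *: P a b (r x)) ->
  forall x, r (\sum_i \sum_j P i j (P j i x)) = \sum_i \sum_j P i j (P j i (r x)).
Proof.
move=> kk rP x.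
transitivity (\sum_i \sum_j \sum_a \sum_b \sum_c \sum_d
   ((k a i * k' i d) * (k c j * k' j b)) *: P a b (P c d (r x))).
  rewrite linear_sum; apply: eq_bigr => i _.
  rewrite linear_sum; apply: eq_bigr => j _ /=.
  rewrite rP; apply: eq_bigr => a _; apply: eq_bigr => b _.
  rewrite rP linear_sum scaler_sumr; apply: eq_bigr => c _ /=.
  rewrite linear_sum scaler_sumr; apply: eq_bigr => d _ /=.
  by rewrite linearZ scalerA /=; congr (_ *: _); ring.
have kkE a d : \sum_i k a i * k' i d = (a == d)%:R.
  by have := congr1 (fun M : 'M[F]_n => M a d) kk; rewrite !mxE.
transitivity (\sum_a \sum_b \sum_c \sum_d
   ((a == d)%:R * (c == b)%:R) *: P a b (P c d (r x))); last first.
  apply: eq_bigr => a _; apply: eq_bigr => b _.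
  rewrite (bigD1 b) //= [X in _ + X]big1 ?addr0 => [|c cb]; last first.
    by rewrite big1 // => d _; rewrite (negPf cb) mulr0 scale0r.
  rewrite (bigD1 a) //= big1 ?addr0 => [|d da].
    by rewrite !eqxx mulr1 scale1r.
  by rewrite eq_sym (negPf da) mul0r scale0r.
transitivity (\sum_(q : 'I_n * 'I_n) \sum_(p : 'I_n * 'I_n * 'I_n * 'I_n)
   ((k p.1.1.1 q.1 * k' q.1 p.2) * (k p.1.2 q.2 * k' q.2 p.1.1.2)) *:
      P p.1.1.1 p.1.1.2 (P p.1.2 p.2 (r x))).
  rewrite pair_bigA; apply: eq_bigr => q _ /=.
  by rewrite !pair_bigA.
rewrite exchange_big /= [RHS]pair_bigA [RHS]pair_bigA [RHS]pair_bigA; apply: eq_bigr => p _ /=.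
by rewrite -scaler_suml -!kkE big_distrlr pair_bigA.
Qed.

Lemma quadratic_linear (F : pzRingType) (V : lmodType F) (I : finType)
    (P : I -> I -> {linear V -> V}) t x y :
  \sum_i \sum_j P i j (P j i (t *: x + y)) =
  t *: (\sum_i \sum_j P i j (P j i x)) + \sum_i \sum_j P i j (P j i y).
Proof.
rewrite scaler_sumr -big_split; apply: eq_bigr => i _ /=.
rewrite scaler_sumr -big_split; apply: eq_bigr => j _ /=.
by rewrite (linearP (P j i)) (linearP (P i j)).
Qed.

(** * Square relations between the coefficients *)
Section Representation.
Variables (R : realType) (V : lmodType R[i]).
Local Notation C := R[i].
Variables (pi rho : 'M[C]_3 -> {linear V -> V}).
Hypothesis V_gK : gK_module pi rho.
Variables (S : set (nat * int)) (v : nat -> int -> nat -> V).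
Hypothesis V_K : Ktype_decomposition pi S v.

Local Notation index := (nat * int * nat)%type.
Definition Kbasis (p : index) : V := v p.1.1 p.1.2 p.2.
Definition Kindex (p : index) : Prop := S (p.1.1, p.1.2) /\ (1 <= p.2 <= p.1.1)%N.

Lemma Kbasis_out p : ~ Kindex p -> Kbasis p = 0.
Proof. exact: (kt_out V_K). Qed.

Definition kcoord : index -> V -> C :=
  @coordv _ V _ Kbasis Kindex Kbasis_out (kt_span V_K).

Lemma kcoord_basis p q : Kindex p -> kcoord q (Kbasis p) = (q == p)%:R.
Proof. by apply: coordv_e; apply: (kt_free V_K). Qed.

HB.instance Definition _ p := GRing.isLinear.Build C V C *%R (kcoord p)
  (coordv_linear Kbasis_out (kt_span V_K) (kt_free V_K) p).

Lemma S_pos n m : S (n, m) -> (0 < n)%N.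
Proof. by move=> /(kt_dom V_K)[]. Qed.

Lemma Kbasis_neq0 p : Kindex p -> Kbasis p != 0.
Proof. exact: (e_neq0 Kbasis_out (kt_span V_K) (kt_free V_K)). Qed.

Lemma Kbasis_ind (P : V -> Prop) x : P 0 ->
  (forall t y z, P y -> P z -> P (t *: y + z)) ->
  (forall p, Kindex p -> kcoord p x != 0 -> P (Kbasis p)) -> P x.
Proof. exact: span_ind. Qed.

Lemma pi_linear t X Y x : sl3 X -> sl3 Y -> pi (t *: X + Y) x = t *: pi X x + pi Y x.
Proof. exact: (gK_linear V_gK). Qed.

Lemma sl3_0 : sl3 (0 : 'M[C]_3). Proof. exact: mxtrace0. Qed.

Lemma pi0 x : pi 0 x = 0.
Proof.
have := pi_linear 1 x sl3_0 sl3_0; rewrite !scale1r addr0.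
by rewrite -[LHS]addr0 => /addrI.
Qed.

Lemma piZ t X x : sl3 X -> pi (t *: X) x = t *: pi X x.
Proof. by move=> sX; rewrite -[t *: X]addr0 pi_linear ?pi0 ?addr0 //; apply: sl3_0. Qed.

Lemma piD X Y x : sl3 X -> sl3 Y -> pi (X + Y) x = pi X x + pi Y x.
Proof. by move=> sX sY; rewrite -[X]scale1r pi_linear // !scale1r. Qed.

Lemma piN X x : sl3 X -> pi (- X) x = - pi X x.
Proof. by move=> sX; rewrite -(scaleN1r X) piZ // scaleN1r. Qed.

Lemma pi_comm X Y W x : sl3 X -> sl3 Y -> X *m Y - Y *m X = W ->
  pi X (pi Y x) = pi Y (pi X x) + pi W x.
Proof. by move=> sX sY <-; rewrite (gK_bracket V_gK) // addrC subrK. Qed.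

Section Coefficients.
Variables a b c d : nat -> int -> C.
Hypothesis V_coef : action_coefficients pi S v a b c d.

Local Notation Xab := (pi (@X_alphabeta R)).
Local Notation Xb := (pi (@X_beta R)).
Local Notation Yab := (pi (@Y_alphabeta R)).
Local Notation Yb := (pi (@Y_beta R)).

Lemma v_out n m k : ~ S (n, m) -> v n m k = 0.
Proof. by move=> nS; apply: (kt_out V_K) => -[]. Qed.

Local Notation chi n m := (`[< S (n, m) >])%:R.

Lemma kcoord_v z n m k : Kindex z -> kcoord z (v n m k) = (z == (n, m, k))%:R.
Proof.
move=> vz; have [vp|nvp] := pselect (Kindex (n, m, k)); first exact: kcoord_basis vp.
rewrite (Kbasis_out nvp : v n m k = 0) linear0.
by case: eqP nvp vz => // ->.
Qed.

(* Where (n, m) is not a K-type, v n m k is 0 but the coefficients with index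
   (n, m) are arbitrary; chi removes them from the formulas below. *)
Lemma Xab_v1 n m : Xab (v n m 1) = (chi n m * a n m) *: v n.+1 (m + 3) 1.
Proof.
have [Sn|nS] := asboolP (S (n, m)); last by rewrite v_out // linear0 mul0r scale0r.
by rewrite (ac_Xab V_coef) ?(S_pos Sn) // subrr !mul0r scale0r addr0 mul1r.
Qed.

Lemma Yb_v1 n m : Yb (v n m 1) = (chi n m * b n m) *: v n.+1 (m - 3) 1.
Proof.
have [Sn|nS] := asboolP (S (n, m)); last by rewrite v_out // linear0 mul0r scale0r.
by rewrite (ac_Yb V_coef) ?(S_pos Sn) // subrr !mul0r scale0r subr0 mul1r.
Qed.

Lemma natr_pred n : n.+1%:R - 1 = n%:R :> C.
Proof. by rewrite -natr1 addrK. Qed.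

Lemma Xb_v1 n m : Xb (v n.+1 m 1) =
  - (chi n.+1 m * a n.+1 m) *: v n.+2 (m + 3) 2 + (chi n.+1 m * c n.+1 m) *: v n (m + 3) 1.
Proof.
have [Sn|nS] := asboolP (S (n.+1, m)).
  rewrite (ac_Xb V_coef) // !mul1r; congr (_ + _ *: _); case: n Sn => [|n] _.
    by rewrite (ac_c1 V_coef) mulr0.
  by rewrite natr_pred divff ?mul1r // pnatr_eq0.
by rewrite v_out // linear0 !mul0r oppr0 !scale0r addr0.
Qed.

Lemma Yab_v1 n m : Yab (v n.+1 m 1) =
  (chi n.+1 m * b n.+1 m) *: v n.+2 (m - 3) 2 + (chi n.+1 m * d n.+1 m) *: v n (m - 3) 1.
Proof.
have [Sn|nS] := asboolP (S (n.+1, m)).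
  rewrite (ac_Yab V_coef) // !mul1r; congr (_ + _ *: _); case: n Sn => [|n] _.
    by rewrite (ac_d1 V_coef) mulr0.
  by rewrite natr_pred divff ?mul1r // pnatr_eq0.
by rewrite v_out // linear0 !mul0r !scale0r addr0.
Qed.

Lemma Xab_v2 n m : Xab (v n.+2 m 2) = (chi n.+2 m * a n.+2 m) *: v n.+3 (m + 3) 2
  + (chi n.+2 m * (c n.+2 m / n.+1%:R)) *: v n.+1 (m + 3) 1.
Proof.
have [Sn|nS] := asboolP (S (n.+2, m)).
  rewrite (ac_Xab V_coef) // !mul1r !natr_pred; congr (_ + _ *: _); ring.
by rewrite v_out // linear0 !mul0r !scale0r addr0.
Qed.

Lemma Yb_v2 n m : Yb (v n.+2 m 2) = (chi n.+2 m * b n.+2 m) *: v n.+3 (m - 3) 2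
  - (chi n.+2 m * (d n.+2 m / n.+1%:R)) *: v n.+1 (m - 3) 1.
Proof.
have [Sn|nS] := asboolP (S (n.+2, m)).
  rewrite (ac_Yb V_coef) // !mul1r !natr_pred; congr (_ - _ *: _); ring.
by rewrite v_out // linear0 !mul0r !scale0r subr0.
Qed.

(** The commutator of X_{alpha+beta} and X_beta is 0.  Applied to the first
    vector of the left corner (n + 1, m) of a square, its component at the first
    vector of the right corner (n + 1, m + 6) compares the way through the bottom
    corner (n, m + 3) with the way through the top corner (n + 2, m + 3). *)
Lemma square_ac n m : S (n.+1, m) -> S (n.+1, m + 3 + 3) ->
  c n.+1 m * (chi n (m + 3) * a n (m + 3)) =
  n.+2%:R / n.+1%:R * (a n.+1 m * (chi n.+2 (m + 3) * c n.+2 (m + 3))).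
Proof.
move=> Sx Sz; set z := (n.+1, m + 3 + 3, 1%N).
have vz : Kindex z by [].
have := pi_comm (v n.+1 m 1) (@sl3_Xab R) (@sl3_Xb R) (comm_Xab_Xb R).
rewrite pi0 addr0 => /(congr1 (kcoord z)).
rewrite Xab_v1 Xb_v1 (asboolT Sx) !mul1r !linearD !linearZ /= Xab_v2 Xab_v1 Xb_v1.
rewrite !linearD !linearZ /= !kcoord_v // !xpair_eqE /= !eqxx.
rewrite !andbF !andbT ?ltn_eqF //= => E.
have n0 : n.+1%:R != 0 :> C by rewrite pnatr_eq0.
apply: (addrI (- a n.+1 m * (chi n.+2 (m + 3) * (c n.+2 (m + 3) / n.+1%:R)))).
rewrite -[n.+2%:R]natr1; move: E; rewrite /GRing.scale /= => E.
transitivity (a n.+1 m * (chi n.+2 (m + 3) * c n.+2 (m + 3))); last by field.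
by apply: etrans (etrans _ E) _; ring.
Qed.

(** The same comparison from the right corner to the left one, from the
    commutator of Y_{alpha+beta} and Y_beta. *)
Lemma square_bd n m : S (n.+1, m) -> S (n.+1, m - 3 - 3) ->
  d n.+1 m * (chi n (m - 3) * b n (m - 3)) =
  n.+2%:R / n.+1%:R * (b n.+1 m * (chi n.+2 (m - 3) * d n.+2 (m - 3))).
Proof.
move=> Sx Sz; set z := (n.+1, m - 3 - 3, 1%N).
have vz : Kindex z by [].
have := pi_comm (v n.+1 m 1) (@sl3_Yab R) (@sl3_Yb R) (comm_Yab_Yb R).
rewrite pi0 addr0 => /(congr1 (kcoord z)).
rewrite Yab_v1 Yb_v1 (asboolT Sx) !mul1r !linearD !linearZ /= Yb_v2 Yb_v1 Yab_v1.
rewrite !linearD !linearN !linearZ /= !kcoord_v // !xpair_eqE /= !eqxx.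
rewrite !andbF !andbT ?ltn_eqF //= => E.
have n0 : n.+1%:R != 0 :> C by rewrite pnatr_eq0.
apply: (addrI (- b n.+1 m * (chi n.+2 (m - 3) * (d n.+2 (m - 3) / n.+1%:R)))).
rewrite -[n.+2%:R]natr1; move: E; rewrite /GRing.scale /= => E.
transitivity (b n.+1 m * (chi n.+2 (m - 3) * d n.+2 (m - 3))); last by field.
apply: etrans (etrans _ (esym E)) _; ring.
Qed.

(** From the bottom corner (n + 1, m) to the top corner (n + 3, m): the
    commutator of X_{alpha+beta} and Y_beta is X_alpha, which kills the first
    vector of V_{n+1,m}. *)
Lemma square_ab n m : S (n.+1, m) -> S (n.+3, m) ->
  a n.+1 m * (chi n.+2 (m + 3) * b n.+2 (m + 3)) =
  b n.+1 m * (chi n.+2 (m - 3) * a n.+2 (m - 3)).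
Proof.
move=> Sx Sz; set z := (n.+3, m, 1%N).
have vz : Kindex z by [].
have := pi_comm (v n.+1 m 1) (@sl3_Xab R) (@sl3_Yb R) (comm_Xab_Yb R).
move=> /(congr1 (kcoord z)).
rewrite (kt_X V_K) // Xab_v1 Yb_v1 (asboolT Sx) !mul1r !linearD !linearZ /= Yb_v1 Xab_v1.
rewrite !linearZ /= (subrK 3 m) (addrK 3 m) !kcoord_v // !xpair_eqE /= !eqxx.
by rewrite !andbF !mulr1 mulr0 addr0 => ->.
Qed.

Lemma kcoord_Xb_v2 n m n' m' : Kindex (n', m', 1%N) ->
  kcoord (n', m', 1%N) (Xb (v n.+2 m 2)) = 0.
Proof.
move=> vz; have [Sn|nS] := pselect (S (n.+2, m)); last by rewrite v_out // !linear0.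
rewrite (ac_Xb V_coef) // !linearD !linearZ /= !kcoord_v //.
by rewrite !xpair_eqE !andbF !mulr0 addr0.
Qed.

Lemma kcoord_Yab_v2 n m n' m' : Kindex (n', m', 1%N) ->
  kcoord (n', m', 1%N) (Yab (v n.+2 m 2)) = 0.
Proof.
move=> vz; have [Sn|nS] := pselect (S (n.+2, m)); last by rewrite v_out // !linear0.
rewrite (ac_Yab V_coef) // !linearD !linearZ /= !kcoord_v //.
by rewrite !xpair_eqE !andbF !mulr0 addr0.
Qed.

(** From the top corner to the bottom one: the commutator of X_beta and
    Y_{alpha+beta} is Y_alpha, which preserves V_{n+3,m} and so contributes
    nothing to the component in V_{n+1,m}. *)
Lemma square_cd n m : S (n.+3, m) -> S (n.+1, m) ->
  c n.+3 m * (chi n.+2 (m + 3) * d n.+2 (m + 3)) =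
  d n.+3 m * (chi n.+2 (m - 3) * c n.+2 (m - 3)).
Proof.
move=> Sx Sz; set z := (n.+1, m, 1%N).
have vz : Kindex z by [].
have := pi_comm (v n.+3 m 1) (@sl3_Xb R) (@sl3_Yab R) (comm_Xb_Yab R).
move=> /(congr1 (kcoord z)).
rewrite (kt_Y V_K) //; set t := - (_ - _).
rewrite Xb_v1 Yab_v1 (asboolT Sx) !mul1r !linearD !linearZ /=.
rewrite [kcoord z (Xb _)]kcoord_Xb_v2 // [kcoord z (Yab _)]kcoord_Yab_v2 //.
rewrite Xb_v1 Yab_v1 !linearD !linearZ /= (subrK 3 m) (addrK 3 m) !kcoord_v //.
by rewrite !xpair_eqE /= !eqxx ?andbF /= !(mulr0, scaler0, add0r, addr0, mulr1) => ->.
Qed.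
End Coefficients.

(** * K-types are stable under K *)
Local Notation E i j := (delta_mx i j : 'M[C]_3).

Definition upper_proj : 'M[C]_3 := 1%:M - E ord_max ord_max.

(** The upper left block of X, completed to a matrix of trace 0 in
    k = s(gl(2) + gl(1)).  The images of the matrix units are dual bases for a
    Casimir operator of gl(2), and the construction commutes with conjugation
    by K. *)
Definition gl2part (X : 'M[C]_3) : 'M[C]_3 :=
  upper_proj *m X *m upper_proj - \tr (upper_proj *m X *m upper_proj) *: (1%:M - upper_proj).

Lemma upper_proj_comm k : Kgrp k -> k *m upper_proj = upper_proj *m k.
Proof.
move=> Kk; have [_ bk _] := (KgrpP k).1 Kk.
rewrite /upper_proj mulmxBr mulmxBl mulmx1 mul1mx; congr (_ - _).
apply/matrixP=> i j; rewrite mxE (bigD1 ord_max) //= big1 ?addr0 => [|l lj]; last first.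
  by rewrite mxE (negPf lj) mulr0.
rewrite [RHS]mxE (bigD1 ord_max) //= big1 ?addr0 => [|l lj]; last first.
  by rewrite mxE (negPf lj) andbF mul0r.
rewrite !mxE eqxx andbT /=.
have [->|i2] := eqVneq i ord_max; have [->|j2] := eqVneq j ord_max; rewrite ?mulr0 ?mul0r //.
- by rewrite mulrC.
- by rewrite bk ?mulr0 // eqxx eq_sym (negPf j2).
- by rewrite bk ?mul0r // eqxx (negPf i2).
Qed.

Lemma gl2part_conj k X : Kgrp k ->
  k *m gl2part X *m invmx k = gl2part (k *m X *m invmx k).
Proof.
move=> Kk; have uk := Kgrp_unit Kk; have kP := upper_proj_comm Kk.
have kPV : invmx k *m upper_proj = upper_proj *m invmx k by apply/upper_proj_comm/KgrpV.
rewrite /gl2part; move: upper_proj kP kPV => P kP kPV.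
have PXP : P *m (k *m X *m invmx k) *m P = k *m (P *m X *m P) *m invmx k.
  by rewrite !mulmxA -kP -!mulmxA kPV.
have trE Y : \tr (k *m Y *m invmx k) = \tr Y by rewrite mxtrace_mulC mulKmx.
rewrite PXP trE mulmxBr mulmxBl -scalemxAr -scalemxAl; congr (_ - _ *: _).
by rewrite mulmxBr mulmxBl kP mulmx1 mulmxK // mulmxV.
Qed.

Lemma sl3_gl2part X : sl3 (gl2part X).
Proof.
have trP : \tr (1%:M - upper_proj) = 1.
  rewrite /upper_proj opprB addrC subrK /mxtrace (bigD1 ord_max) //= big1 ?mxE ?eqxx ?addr0 //.
  by move=> h hl; rewrite mxE (negPf hl).
by rewrite /sl3 /= /gl2part mxtraceD -scaleNr mxtraceZ trP mulr1 subrr.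
Qed.

Lemma gl2part_linear t X Y : gl2part (t *: X + Y) = t *: gl2part X + gl2part Y.
Proof.
rewrite /gl2part; move: upper_proj => P; rewrite mulmxDr mulmxDl -scalemxAr -scalemxAl mxtraceD mxtraceZ.
by move: (1%:M - P) => Q; rewrite scalerDl -scalerA scalerBr opprD addrACA.
Qed.

Local Notation e i j := (gl2part (E i j)).

Lemma gl2_conj k i j : Kgrp k ->
  k *m e i j *m invmx k = \sum_a \sum_b (k a i * invmx k j b) *: e a b.
Proof.
move=> Kk; rewrite gl2part_conj //.
have gl2partD X Y : gl2part (X + Y) = gl2part X + gl2part Y.
  by rewrite -[X]scale1r gl2part_linear !scale1r.
have gl2part0 : gl2part 0 = 0.
  by apply: (addrI (gl2part 0)); rewrite -gl2partD !addr0.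
have gl2partZ t X : gl2part (t *: X) = t *: gl2part X.
  by rewrite -[t *: X]addr0 gl2part_linear gl2part0 addr0.
rewrite [k *m _ *m _]matrix_sum_delta.
rewrite (big_morph _ gl2partD gl2part0); apply: eq_bigr => a _.
rewrite (big_morph _ gl2partD gl2part0); apply: eq_bigr => b _.
rewrite gl2partZ; congr (_ *: _).
rewrite mxE (bigD1 j) //= big1 ?addr0 => [|l lj].
  rewrite mxE (bigD1 i) //= big1 ?addr0 => [|l li]; first by rewrite mxE !eqxx mulr1.
  by rewrite mxE (negPf li) mulr0.
by rewrite mxE big1 ?mul0r // => h _; rewrite mxE (negPf lj) andbF mulr0.
Qed.

Definition casimir x := \sum_i \sum_j pi (e i j) (pi (e j i) x).

Lemma pi_sum (I : finType) (F : I -> C) (X : I -> 'M[C]_3) x :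
  (forall i, sl3 (X i)) -> pi (\sum_i F i *: X i) x = \sum_i F i *: pi (X i) x.
Proof.
move=> sX.
suff [] : sl3 (\sum_i F i *: X i) /\ pi (\sum_i F i *: X i) x = \sum_i F i *: pi (X i) x by [].
elim/big_rec2: _ => [|i y X' _ [sX' XE]]; first by rewrite pi0; split=> //; apply: sl3_0.
by split; [apply: sl3_linear | rewrite pi_linear // XE].
Qed.

Lemma pi_conj_gl2 k i j x : Kgrp k -> pi (k *m e i j *m invmx k) x =
  \sum_a \sum_b (k a i * invmx k j b) *: pi (e a b) x.
Proof.
move=> Kk; rewrite gl2_conj // pair_bigA pi_sum ?pair_bigA // => p.
exact: sl3_gl2part.
Qed.

Lemma casimir_rho k x : Kgrp k -> rho k (casimir x) = casimir (rho k x).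
Proof.
move=> Kk; apply: (casimir_invariant (mulmxV (Kgrp_unit Kk))) => i j y.
by rewrite (gK_Ad V_gK) ?pi_conj_gl2 //; apply: sl3_gl2part.
Qed.

Lemma pi_Z_rho k x : Kgrp k -> rho k (pi (@Z_k R) x) = pi (@Z_k R) (rho k x).
Proof.
move=> Kk; rewrite (gK_Ad V_gK) //; last exact: sl3_Z.
have ZE : @Z_k R = upper_proj - 2 *: (1%:M - upper_proj).
  rewrite /upper_proj opprB [1%:M + (_ - _)]addrC subrK.
  have e2 (h : (2 < 3)%N) : Ordinal h = 2 :> 'I_3 by apply/eqP.
  apply/matrixP=> i j.
  by case: i => [[|[|[|//]]] hi]; case: j => [[|[|[|//]]] hj]; rewrite !mxE /=; ring.
suff -> : k *m @Z_k R *m invmx k = @Z_k R by [].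
have kP := upper_proj_comm Kk; rewrite ZE; move: upper_proj kP => P kP.
rewrite mulmxBr -scalemxAr mulmxBr kP mulmx1 mulmxBl -scalemxAl mulmxBl.
by rewrite mulmxK ?mulmxV ?Kgrp_unit.
Qed.

Lemma gl2partE X s t : gl2part X s t = (s != ord_max)%:R * (t != ord_max)%:R * X s t
  - (X 0 0 + X 1 1) * ((s == ord_max) && (t == ord_max))%:R.
Proof.
have PXP s' t' : (upper_proj *m X *m upper_proj) s' t' = (s' != ord_max)%:R * (t' != ord_max)%:R * X s' t'.
  have PE i j : upper_proj i j = (i != ord_max)%:R * (i == j)%:R.
    rewrite !mxE; have [->|ij] := eqVneq i j.
      by case: eqP; rewrite ?subrr ?subr0 ?mulr1 ?mul0r.
    rewrite mulr0; case: (eqVneq i ord_max) ij => [->|_] //=; rewrite ?subr0 //.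
    by rewrite eq_sym => /negPf ->; rewrite subr0.
  rewrite mxE (bigD1 t') //= big1 ?addr0 => [|l lt]; last by rewrite PE (negPf lt) !mulr0.
  rewrite mxE (bigD1 s') //= big1 ?addr0 => [|l ls]; last first.
    by rewrite PE (eq_sym s' l) (negPf ls) mulr0 mul0r.
  by rewrite !PE !eqxx !mulr1 mulrAC.
have -> : gl2part X s t = (upper_proj *m X *m upper_proj) s t -
    \tr (upper_proj *m X *m upper_proj) * ((s == ord_max) && (t == ord_max))%:R.
  have QE : 1%:M - upper_proj = E ord_max ord_max by rewrite /upper_proj opprB addrC subrK.
  by rewrite /gl2part QE; move: (upper_proj *m X *m upper_proj) => Y; rewrite !mxE.
rewrite PXP /mxtrace !big_ord_recl big_ord0 !PXP /= !mul1r mul0r mul0r !addr0.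
congr (_ - (_ + X _ _) * _); exact: val_inj.
Qed.

Lemma pi_half_sum A B x : sl3 A -> sl3 B ->
  pi (2^-1 *: (A + B)) x = 2^-1 *: (pi A x + pi B x).
Proof.
move=> sA sB; have sAB : sl3 (A + B) by rewrite -[A]scale1r; apply: sl3_linear.
by rewrite piZ // piD.
Qed.

Lemma pi_half_diff A B x : sl3 A -> sl3 B ->
  pi (2^-1 *: (A - B)) x = 2^-1 *: (pi A x - pi B x).
Proof.
move=> sA sB; have sB' : sl3 (- B).
  by rewrite -[- B]addr0 -scaleN1r; apply: sl3_linear => //; apply: sl3_0.
by rewrite pi_half_sum // piN.
Qed.

Lemma kcoord_inj x y : (forall p, kcoord p x = kcoord p y) -> x = y.
Proof.
move=> xy; apply/eqP; rewrite -subr_eq0; apply/eqP.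
apply: (@coordv_eq0 _ _ _ _ _ Kbasis_out (kt_span V_K)) => p; change (kcoord p (x - y) = 0).
by rewrite linearB /= xy subrr.
Qed.

Lemma half_squares (z h : {linear V -> V}) x :
  2^-1 *: (z (2^-1 *: (z x + h x)) + h (2^-1 *: (z x + h x))) +
  2^-1 *: (z (2^-1 *: (z x - h x)) - h (2^-1 *: (z x - h x))) =
  2^-1 *: (z (z x) + h (h x)).
Proof.
rewrite !linearZ !linearD !linearN /=.
(* A scalar identity in each coordinate. *)
apply: kcoord_inj => p; rewrite !(linearD, linearN) !linearZ /= !(linearD, linearN) /= !linearZ /=.
by rewrite /GRing.scale /=; field.
Qed.

Lemma sum_block2 (P : 'I_3 -> 'I_3 -> {linear V -> V}) :
  (forall i y, P i ord_max y = 0) -> (forall i y, P ord_max i y = 0) ->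
  forall x, \sum_i \sum_j P i j (P j i x) =
    P 0 0 (P 0 0 x) + P 1 1 (P 1 1 x) + (P 0 1 (P 1 0 x) + P 1 0 (P 0 1 x)).
Proof.
move=> Pi2 P2i x.
have l1 : lift ord0 ord0 = 1 :> 'I_3 by apply/eqP.
have l2 : lift ord0 (lift ord0 ord0) = ord_max :> 'I_3 by apply/eqP.
rewrite !big_ord_recl !big_ord0 l1 l2 !P2i !Pi2 !addr0.
by rewrite addrACA [X in _ + X]addrC addrACA [X in _ + X = _]addrC.
Qed.

(** The blocks of (Z + H_alpha) / 2 and (Z - H_alpha) / 2 are E_11 and E_22. *)
Lemma casimirE x : casimir x = 2^-1 *: (pi (@Z_k R) (pi (@Z_k R) x) +
  pi (@H_alpha R) (pi (@H_alpha R) x)) +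
  (pi (@X_alpha R) (pi (@Y_alpha R) x) + pi (@Y_alpha R) (pi (@X_alpha R) x)).
Proof.
have e0 (h : (0 < 3)%N) : Ordinal h = 0 :> 'I_3 by apply/eqP.
have e1 (h : (1 < 3)%N) : Ordinal h = 1 :> 'I_3 by apply/eqP.
have e2 (h : (2 < 3)%N) : Ordinal h = 2 :> 'I_3 by apply/eqP.
have E00 : e 0 0 = 2^-1 *: (@Z_k R + @H_alpha R).
  apply/matrixP=> i j.
  by case: i => [[|[|[|//]]] hi]; case: j => [[|[|[|//]]] hj];
    rewrite gl2partE !mxE /=; field.
have E11 : e 1 1 = 2^-1 *: (@Z_k R - @H_alpha R).
  apply/matrixP=> i j.
  by case: i => [[|[|[|//]]] hi]; case: j => [[|[|[|//]]] hj];
    rewrite gl2partE !mxE /=; field.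
have E01 : e 0 1 = @X_alpha R.
  apply/matrixP=> i j.
  by case: i => [[|[|[|//]]] hi]; case: j => [[|[|[|//]]] hj];
    rewrite gl2partE !mxE /=; ring.
have E10 : e 1 0 = @Y_alpha R.
  apply/matrixP=> i j.
  by case: i => [[|[|[|//]]] hi]; case: j => [[|[|[|//]]] hj];
    rewrite gl2partE !mxE /=; ring.
have n02 : (0 == ord_max :> 'I_3) = false by [].
have n12 : (1 == ord_max :> 'I_3) = false by [].
have Ei2 i : e i ord_max = 0.
  apply/matrixP=> s t; rewrite gl2partE !mxE n02 n12 !andbF addr0 mul0r subr0.
  by case: (t == ord_max) => /=; rewrite ?andbF ?mulr0 ?mul0r.
have E2i i : e ord_max i = 0.
  apply/matrixP=> s t; rewrite gl2partE !mxE n02 n12 !andFb addr0 mul0r subr0.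
  by case: (s == ord_max) => /=; rewrite ?mul0r ?mulr0.
have -> : casimir x = pi (e 0 0) (pi (e 0 0) x) + pi (e 1 1) (pi (e 1 1) x) +
    (pi (e 0 1) (pi (e 1 0) x) + pi (e 1 0) (pi (e 0 1) x)).
  by apply: (@sum_block2 (fun i j => pi (e i j))) => i y; rewrite (Ei2, E2i) pi0.
rewrite E00 E11 E01 E10; congr (_ + _).
have sZ := sl3_Z R; have sH := sl3_Ha R.
rewrite !(pi_half_sum _ sZ sH) !(pi_half_diff _ sZ sH); exact: half_squares.
Qed.

(** Together with the eigenvalue m of Z, the eigenvalue (m^2 + n^2 - 1) / 2
    determines n, as n is positive. *)
Lemma casimir_basis p : Kindex p -> casimir (Kbasis p) =
  ((p.1.2%:~R ^+ 2 + p.1.1%:R ^+ 2 - 1) / 2) *: Kbasis p.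
Proof.
case: p => [[n m] k] [/= Sp kp]; rewrite /Kbasis /= casimirE.
have XY : pi (@X_alpha R) (pi (@Y_alpha R) (v n m k)) = (k%:R * (n%:R - k%:R)) *: v n m k.
  rewrite (kt_Y V_K) // linearZ /=; have [kn|kn] := ltnP k n; last first.
    have -> : k = n by apply/eqP; rewrite eqn_leq kn; case/andP: kp => _ ->.
    by rewrite subrr oppr0 mulr0 !scale0r.
  rewrite (kt_X V_K) //= scalerA -natr1; congr (_ *: _); ring.
have YX : pi (@Y_alpha R) (pi (@X_alpha R) (v n m k)) =
    ((k%:R - 1) * (n%:R - k%:R + 1)) *: v n m k.
  rewrite (kt_X V_K) // linearZ /=; case: k kp {XY} => [//|[|k]] kp.
    by rewrite subrr oppr0 mul0r !scale0r.
  rewrite (kt_Y V_K) ?(ltnW kp) //= scalerA -[k.+2%:R]natr1; congr (_ *: _); ring.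
rewrite XY YX (kt_H V_K) // (kt_Z V_K) //; set h := n%:R + 1 - _.
rewrite !linearZ /= (kt_H V_K) // (kt_Z V_K) // -/h !scalerA -!scalerDl scalerA -scalerDl.
by congr (_ *: _); rewrite /h; field.
Qed.

Lemma kcoord_eigen (f : V -> V) (l : index -> C) : (forall t x y, f (t *: x + y) = t *: f x + f y) ->
  (forall p, Kindex p -> f (Kbasis p) = l p *: Kbasis p) ->
  forall q x, kcoord q (f x) = l q * kcoord q x.
Proof.
move=> flin fl q x.
have [vq|nvq] := pselect (Kindex q); last first.
  have kc0 y : kcoord q y = 0.
    by apply/eqP; apply: contra_notT nvq => h; apply: (coordv_valid h).
  by rewrite !kc0 mulr0.
apply: (@Kbasis_ind (fun x => kcoord q (f x) = l q * kcoord q x)) => [|t y z fy fz|p vp _].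
- have -> : f 0 = 0 by have := flin (-1) 0 0; rewrite scaler0 addr0 scaleN1r addNr.
  by rewrite !linear0 mulr0.
- by rewrite flin !linearP /= fy fz; ring.
- by rewrite fl // linearZ /= kcoord_basis //; case: eqP => [->|]; rewrite ?mulr0.
Qed.

Lemma casimir_linear t x y : casimir (t *: x + y) = t *: casimir x + casimir y.
Proof. exact: (quadratic_linear (fun i j => pi (e i j))). Qed.

(** The operators Z and casimir commute with K and separate the K-types. *)
Lemma Ktype_rho_stable k p q : Kgrp k -> Kindex p -> kcoord q (rho k (Kbasis p)) != 0 ->
  q.1 = p.1.
Proof.
move=> Kk vp cq.
have mE : q.1.2 = p.1.2.
  have := kcoord_eigen (fun t x y => linearP _ _ _ _)
    (fun r (vr : Kindex r) => kt_Z V_K vr.1 vr.2) q (rho k (Kbasis p)).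
  rewrite -pi_Z_rho // (kt_Z V_K vp.1 vp.2) !linearZ /= => /(mulIf cq).
  by move=> /eqP; rewrite eqr_int => /eqP.
have := kcoord_eigen casimir_linear casimir_basis q (rho k (Kbasis p)).
rewrite -casimir_rho // casimir_basis // !linearZ /= => /(mulIf cq).
move=> /divIf; rewrite mE pnatr_eq0 => /(_ isT)/addIr/addrI/eqP.
have vq : Kindex q.
  by apply: (@coordv_valid _ _ _ Kbasis Kindex Kbasis_out (kt_span V_K) (rho k (Kbasis p))).
rewrite eqf_sqr => /orP[|].
  by rewrite eqr_nat => /eqP nE; rewrite [q.1]surjective_pairing mE -nE -surjective_pairing.
by rewrite -addr_eq0 -natrD pnatr_eq0 addn_eq0 (gtn_eqF (S_pos vp.1)).
Qed.
End Representation.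

(** * The graph of K-types *)
Section Connectivity.
Variables (R : realType) (V : lmodType R[i]).
Local Notation C := R[i].
Variables (pi rho : 'M[C]_3 -> {linear V -> V}).
Hypothesis V_gK : gK_module pi rho.
Hypothesis V_irr : gK_irreducible pi rho.
Variables (S : set (nat * int)) (v : nat -> int -> nat -> V).
Hypothesis V_K : Ktype_decomposition pi S v.
Variables a b c d : nat -> int -> C.
Hypothesis V_coef : action_coefficients pi S v a b c d.

(** T contains the end points of all edges that start in T and along which the
    action of sl(3,C) moves vectors. *)
Definition step_closed (T : nat -> int -> Prop) := forall n m, S (n, m) -> T n m ->
  [/\ S (n.+1, m + 3) -> a n m != 0 -> T n.+1 (m + 3),
      S (n.+1, m - 3) -> b n m != 0 -> T n.+1 (m - 3),
      S (n.-1, m + 3) -> c n m != 0 -> T n.-1 (m + 3) &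
      S (n.-1, m - 3) -> d n m != 0 -> T n.-1 (m - 3)].

(** The K-types in T span a submodule, which is V by irreducibility. *)
Lemma step_closed_full (T : nat -> int -> Prop) n0 m0 :
  S (n0, m0) -> T n0 m0 -> step_closed T -> forall n m, S (n, m) -> T n m.
Proof.
move=> S0 T0 Tstep.
pose W : set V := [set x | forall p, kcoord V_K p x != 0 -> T p.1.1 p.1.2].
have W0 : W 0 by move=> p; rewrite linear0 eqxx.
have Wlin t x y : W x -> W y -> W (t *: x + y).
  move=> Wx Wy p; rewrite linearP /=.
  have [xp|/Wx //] := eqVneq (kcoord V_K p x) 0.
  have [yp|/Wy //] := eqVneq (kcoord V_K p y) 0.
  by rewrite xp yp mulr0 addr0 eqxx.
have WZ t x : W x -> W (t *: x) by move=> Wx; rewrite -[_ *: x]addr0; apply: Wlin.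
have WD x y : W x -> W y -> W (x + y) by move=> Wx; rewrite -[x]scale1r; apply: Wlin.
have Wv t n m k : (S (n, m) -> t != 0 -> T n m) -> W (t *: v n m k).
  move=> Tnm; have [->|t0] := eqVneq t 0; first by rewrite scale0r.
  have [vp|nvp] := pselect (Kindex S (n, m, k)); last first.
    by have -> : v n m k = 0 by [exact: (Kbasis_out V_K nvp)]; rewrite scaler0.
  move=> p; rewrite linearZ /= (kcoord_basis V_K p vp) /=.
  by case: (p =P _) => [-> _ | _]; [apply: Tnm => //; case: vp | rewrite mulr0 eqxx].
have Wpi X p : sl3 X -> Kindex S p -> T p.1.1 p.1.2 -> W (pi X (Kbasis v p)).
  move=> sX [Sp kp] Tp; move: X sX; have [Ta Tb Tc Td] := Tstep _ _ Sp Tp.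
  rewrite /Kbasis; apply: sl3_ind.
  - by move=> t X Y sX sY WX WY; rewrite (pi_linear V_gK) //; apply: Wlin.
  - by rewrite (kt_H V_K) //; apply: Wv.
  - by rewrite (kt_Z V_K) //; apply: Wv.
  - by rewrite (kt_X V_K) //; apply: Wv.
  - rewrite (ac_Xb V_coef) //; apply: WD; [apply: Wv => /Ta; rewrite ?oppr_eq0 // | apply: Wv => /Tc].
    by rewrite mulf_eq0 negb_or => h /andP[_]; apply: h.
  - rewrite (ac_Xab V_coef) //; apply: WD; [by apply: Wv => /Ta | apply: Wv => /Tc].
    by rewrite mulf_eq0 negb_or => h /andP[_]; apply: h.
  - by rewrite (kt_Y V_K) //; apply: Wv.
  - rewrite (ac_Yb V_coef) // -scaleNr; apply: WD; [by apply: Wv => /Tb | apply: Wv => /Td].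
    by rewrite oppr_eq0 mulf_eq0 negb_or => h /andP[_]; apply: h.
  - rewrite (ac_Yab V_coef) //; apply: WD; [by apply: Wv => /Tb | apply: Wv => /Td].
    by rewrite mulf_eq0 negb_or => h /andP[_]; apply: h.
have Wsub : gK_submodule pi rho W.
  split=> // [X x sX Wx|k x Kk Wx].
    apply: (@Kbasis_ind _ _ _ _ _ V_K (fun y => W (pi X y)) x); first by rewrite linear0.
      by move=> t y z; rewrite linearP; apply: Wlin.
    by move=> p vp /Wx; apply: Wpi.
  apply: (@Kbasis_ind _ _ _ _ _ V_K (fun y => W (rho k y)) x); first by rewrite linear0.
    by move=> t y z; rewrite linearP; apply: Wlin.
  by move=> p vp /Wx Tp q /(Ktype_rho_stable V_gK Kk vp) ->.
have v1 n m : S (n, m) -> Kindex S (n, m, 1%N) by move=> Snm; split=> //=; exact: (S_pos V_K Snm).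
have [W_0|WT] := V_irr.2 W Wsub.
  have : W (1 *: v n0 m0 1) by apply: Wv.
  rewrite W_0 scale1r /= => v0; have := Kbasis_neq0 V_K (v1 _ _ S0).
  by rewrite /Kbasis /= v0 eqxx.
move=> n m Snm; have : W (v n m 1) by rewrite WT.
by move=> /(_ (n, m, 1%N)) /=; apply; rewrite (kcoord_basis V_K _ (v1 _ _ Snm)) eqxx oner_eq0.
Qed.

Hypothesis ad_sym : forall n m, S (n, m) -> S (n.+1, m + 3) ->
  (a n m != 0) = (d n.+1 (m + 3) != 0).
Hypothesis bc_sym : forall n m, S (n, m) -> S (n.+1, m - 3) ->
  (b n m != 0) = (c n.+1 (m - 3) != 0).

Definition ad_edge n m := [/\ S (n, m), S (n.+1, m + 3) & a n m != 0].
Definition bc_edge n m := [/\ S (n, m), S (n.+1, m - 3) & b n m != 0].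
(** The square with bottom (n, m), right corner (n + 1, m + 3), left corner
    (n + 1, m - 3) and top (n + 2, m). *)
Definition nat_square n m :=
  [/\ ad_edge n m, ad_edge n.+1 (m - 3), bc_edge n m & bc_edge n.+1 (m + 3)].

(** The way from the right corner to the left one through the bottom has a
    nonzero coefficient, hence so has the way through the top. *)
Lemma square_from_bottom n m : ad_edge n m -> bc_edge n m -> nat_square n m.
Proof.
move=> [S00 S10 a00] [_ S01 b00].
have d10 : d n.+1 (m + 3) != 0 by rewrite -ad_sym.
have := square_bd V_gK V_K V_coef S10.
rewrite addrK => /(_ S01) E.
have : d n.+1 (m + 3) * (`[< S (n, m) >]%:R * b n m) != 0.
  by rewrite asboolT // mul1r mulf_neq0.
rewrite E !mulf_eq0 !negb_or => /andP[_ /andP[b10 /andP[S11 d11]]].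
have {}S11 : S (n.+2, m) by move: S11; case: asboolP; rewrite ?eqxx.
have mE : m - 3 + 3 = m by rewrite subrK.
have mE' : m + 3 - 3 = m by rewrite addrK.
split; split=> //; rewrite ?mE ?mE' //.
by rewrite ad_sym ?mE.
Qed.

(** Here and for the left corner, the good edges form a way from the bottom to
    the top. *)
Lemma square_from_right n m : ad_edge n m -> bc_edge n.+1 (m + 3) -> nat_square n m.
Proof.
move=> [S00 S10 a00] [_]; rewrite addrK => S11 b10.
case: n S00 S10 a00 S11 b10 => [|n] S00; first by have := S_pos V_K S00.
move=> S10 a00 S11 b10; have := square_ab V_gK V_K V_coef S00 S11; rewrite asboolT // mul1r => E.
have : a n.+1 m * b n.+2 (m + 3) != 0 by rewrite mulf_neq0.
rewrite E !mulf_eq0 !negb_or => /andP[b00 /andP[S01 a01]].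
have {}S01 : S (n.+2, m - 3) by move: S01; case: asboolP; rewrite ?eqxx.
by split; split; rewrite ?subrK ?addrK.
Qed.

Lemma square_from_left n m : bc_edge n m -> ad_edge n.+1 (m - 3) -> nat_square n m.
Proof.
move=> [S00 S01 b00] [_]; rewrite subrK => S11 a01.
case: n S00 S01 b00 S11 a01 => [|n] S00; first by have := S_pos V_K S00.
move=> S01 b00 S11 a01; have := square_ab V_gK V_K V_coef S00 S11.
rewrite [in RHS]asboolT // mul1r => E.
have : b n.+1 m * a n.+2 (m - 3) != 0 by rewrite mulf_neq0.
rewrite -E !mulf_eq0 !negb_or => /andP[a00 /andP[S10 b10]].
have {}S10 : S (n.+2, m + 3) by move: S10; case: asboolP; rewrite ?eqxx.
by split; split; rewrite ?subrK ?addrK.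
Qed.

(** The two ways from the left corner to the right one are compared.  The
    relation also yields that the bottom is a K-type, hence n > 0. *)
Lemma square_from_top n m : ad_edge n.+1 (m - 3) -> bc_edge n.+1 (m + 3) -> nat_square n m.
Proof.
move=> [S01]; rewrite subrK => S11 a01 [S10 _ b10].
have := square_ac V_gK V_K V_coef S01; rewrite subrK => /(_ S10) E.
have c11 : c n.+2 m != 0.
  by have := bc_sym S10; rewrite addrK => <-.
have : n.+2%:R / n.+1%:R * (a n.+1 (m - 3) * (`[< S (n.+2, m) >]%:R * c n.+2 m)) != 0.
  by rewrite asboolT // mul1r !mulf_neq0 // ?invr_eq0 pnatr_eq0.
rewrite -E !mulf_eq0 !negb_or => /andP[c01 /andP[S00 a00]].
have {}S00 : S (n, m) by move: S00; case: asboolP; rewrite ?eqxx.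
by split; split; rewrite ?subrK ?addrK // bc_sym.
Qed.

(** The grid point (u, w) stands for (n, m) with n = n0 + u + w and
    m = m0 + 3 (u - w): u counts the steps (1, 3) and w the steps (1, -3) from
    the base point (n0, m0).  Points with negative n carry no edges. *)
Definition grid_edge (edge : nat -> int -> Prop) n0 m0 (u w : int) :=
  exists n : nat, n%:Z = n0%:Z + u + w /\ edge n (m0 + 3 * (u - w)).

Lemma grid_corners_fill n0 m0 :
  corners_fill (grid_edge ad_edge n0 m0) (grid_edge bc_edge n0 m0).
Proof.
move=> u w.
have up : m0 + 3 * (u - (w + 1)) = m0 + 3 * (u - w) - 3 by ring.
have right : m0 + 3 * (u + 1 - w) = m0 + 3 * (u - w) + 3 by ring.
have nat_to_grid (n : nat) : n%:Z = n0%:Z + u + w -> nat_square n (m0 + 3 * (u - w)) ->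
    full_square (grid_edge ad_edge n0 m0) (grid_edge bc_edge n0 m0) u w.
  move=> nE [e1 e2 e3 e4]; split.
  - by exists n.
  - by exists n.+1; rewrite up; split=> //; lia.
  - by exists n.
  - by exists n.+1; rewrite right; split=> //; lia.
split=> -[n [nE e1]] [n' [nE' e2]].
- apply: (nat_to_grid n) => //; have nn : n' = n by lia.
  by apply: square_from_bottom => //; rewrite -nn.
- apply: (nat_to_grid n) => //; have nn : n' = n.+1 by lia.
  by apply: square_from_right => //; rewrite -nn -right.
- apply: (nat_to_grid n') => //; have nn : n = n'.+1 by lia.
  by apply: square_from_left => //; rewrite -nn -up.
- case: n nE e1 => [|n] nE e1; first by case: e1 => /(S_pos V_K).
  apply: (nat_to_grid n) => //; first lia.
  have nn : n' = n.+1 by lia.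
  by apply: square_from_top; rewrite -?up // -nn -right.
Qed.

Definition grid_reached n0 m0 (n : nat) (m : int) := exists u w : int,
  [/\ n%:Z = n0%:Z + u + w, m = m0 + 3 * (u - w) &
      full_rect (grid_edge ad_edge n0 m0) (grid_edge bc_edge n0 m0) u w].

(** A good edge that starts at a point with full rectangle ends at a point with
    full rectangle. *)
Lemma grid_reached_all n0 m0 : S (n0, m0) ->
  forall n m, S (n, m) -> grid_reached n0 m0 n m.
Proof.
move=> S0; have fill := grid_corners_fill n0 m0.
apply: (step_closed_full S0).
  by exists 0, 0; split; [lia | ring | exact: full_rect0].
move=> n m Snm [u [w [nE mE r]]]; have n_gt0 := S_pos V_K Snm; split.
- move=> S' a0; exists (u + 1), w; split; [lia | rewrite mE; ring |].
  have e : grid_edge ad_edge n0 m0 u w by exists n; rewrite -mE.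
  exact: (full_rect_h fill e).1.
- move=> S' b0; exists u, (w + 1); split; [lia | rewrite mE; ring |].
  have e : grid_edge bc_edge n0 m0 u w by exists n; rewrite -mE.
  exact: (full_rect_v fill e).1.
- move=> S' c0; exists u, (w - 1); split; [lia | rewrite mE; ring |].
  have e : grid_edge bc_edge n0 m0 u (w - 1).
    exists n.-1; rewrite (_ : m0 + 3 * _ = m + 3); last by rewrite mE; ring.
    split; first lia.
    have mE' : m + 3 - 3 = m by ring.
    split=> //; first by rewrite prednK ?mE'.
    by rewrite bc_sym // ?prednK ?mE'.
  by apply: (full_rect_v fill e).2; rewrite subrK.
- move=> S' d0; exists (u - 1), w; split; [lia | rewrite mE; ring |].
  have e : grid_edge ad_edge n0 m0 (u - 1) w.
    exists n.-1; rewrite (_ : m0 + 3 * _ = m - 3); last by rewrite mE; ring.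
    split; first lia.
    have mE' : m - 3 + 3 = m by ring.
    split=> //; first by rewrite prednK ?mE'.
    by rewrite ad_sym // ?prednK ?mE'.
  by apply: (full_rect_h fill e).2; rewrite subrK.
Qed.

(** With (n, m) as the base point, the rectangle up to its neighbour is the edge
    between them. *)
Lemma ad_neq0 n m : S (n, m) -> S (n.+1, m + 3) -> a n m != 0.
Proof.
move=> S0 S1; have [u [w [nE mE [r _]]]] := grid_reached_all S0 S1.
have [n' [nE' [_ _]]] : grid_edge ad_edge n m 0 0 by apply: r; lia_between.
by have -> : n' = n by [lia]; rewrite subrr mulr0 addr0.
Qed.

Lemma bc_neq0 n m : S (n, m) -> S (n.+1, m - 3) -> b n m != 0.
Proof.
move=> S0 S1; have [u [w [nE mE [_ r]]]] := grid_reached_all S0 S1.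
have [n' [nE' [_ _]]] : grid_edge bc_edge n m 0 0 by apply: r; lia_between.
by have -> : n' = n by [lia]; rewrite subrr mulr0 addr0.
Qed.

End Connectivity.

(** * Norms with prescribed ratios *)
Section NormPotential.
Variables (R : realType) (V : lmodType R[i]).
Local Notation C := R[i].
Variables (pi rho : 'M[C]_3 -> {linear V -> V}).
Hypothesis V_gK : gK_module pi rho.
Hypothesis V_irr : gK_irreducible pi rho.
Variables (S : set (nat * int)) (v : nat -> int -> nat -> V).
Hypothesis V_K : Ktype_decomposition pi S v.
Variables a b c d : nat -> int -> C.
Hypothesis V_coef : action_coefficients pi S v a b c d.
Hypothesis ad_lt0 : forall n m, S (n, m) -> S (n.+1, m + 3) -> a n m * d n.+1 (m + 3) < 0.
Hypothesis bc_lt0 : forall n m, S (n, m) -> S (n.+1, m - 3) -> b n m * c n.+1 (m - 3) < 0.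

Lemma norm_ratio_gt0 (x y : C) : x * y < 0 -> 0 < - y^* / x.
Proof.
move=> xy; have x0 : x != 0 by apply: contraTneq xy => ->; rewrite mul0r ltxx.
have y0 : y != 0 by apply: contraTneq xy => ->; rewrite mulr0 ltxx.
have -> : - y^* / x = (y * y^* ) / (- (x * y)) by field; rewrite x0 y0.
by rewrite divr_gt0 ?oppr_gt0 // mul_conjC_gt0.
Qed.

Lemma mul_lt0_neq0 (x y : C) : x * y < 0 -> (x != 0) * (y != 0).
Proof. by move=> /ltr0_neq0; rewrite mulf_eq0 negb_or => /andP[]. Qed.

(** The required ratios of norms along the good edges form a cocycle: the
    numerators and the denominators around a square are compared by square_cd and
    square_ab. *)
Lemma norms_exist n0 m0 : S (n0, m0) -> exists N : nat -> int -> C,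
  [/\ forall n m, 0 < N n m,
      forall n m, S (n, m) -> S (n.+1, m + 3) ->
        a n m * N n.+1 (m + 3) = - (d n.+1 (m + 3))^* * N n m &
      forall n m, S (n, m) -> S (n.+1, m - 3) ->
        b n m * N n.+1 (m - 3) = - (c n.+1 (m - 3))^* * N n m].
Proof.
move=> S0.
have ad_sym n m : S (n, m) -> S (n.+1, m + 3) -> (a n m != 0) = (d n.+1 (m + 3) != 0).
  by move=> h h'; rewrite !(mul_lt0_neq0 (ad_lt0 h h')).
have bc_sym n m : S (n, m) -> S (n.+1, m - 3) -> (b n m != 0) = (c n.+1 (m - 3) != 0).
  by move=> h h'; rewrite !(mul_lt0_neq0 (bc_lt0 h h')).
pose gn (u w : int) := `|(n0%:Z + u + w)%R|%N.
pose gm (u w : int) : int := m0 + 3 * (u - w).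
pose Eh := grid_edge (ad_edge S a) n0 m0; pose Ev := grid_edge (bc_edge S b) n0 m0.
pose rh u w := if `[< Eh u w >] then
  - (d (gn u w).+1 (gm u w + 3))^* / a (gn u w) (gm u w) else 1.
pose rv u w := if `[< Ev u w >] then
  - (c (gn u w).+1 (gm u w - 3))^* / b (gn u w) (gm u w) else 1.
have gnE (n : nat) u w : n%:Z = n0%:Z + u + w -> gn u w = n by rewrite /gn => <-.
have rhE u w : Eh u w -> S (gn u w, gm u w) /\ S ((gn u w).+1, gm u w + 3).
  by move=> [n [/gnE -> [? ?]]].
have rvE u w : Ev u w -> S (gn u w, gm u w) /\ S ((gn u w).+1, gm u w - 3).
  by move=> [n [/gnE -> [? ?]]].
have rh_gt0 u w : 0 < rh u w.
  by rewrite /rh; case: asboolP => // /rhE[h h']; apply: norm_ratio_gt0 (ad_lt0 h h').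
have rv_gt0 u w : 0 < rv u w.
  by rewrite /rv; case: asboolP => // /rvE[h h']; apply: norm_ratio_gt0 (bc_lt0 h h').
have cocycle u w : full_square Eh Ev u w -> rh u w * rv (u + 1) w = rv u w * rh u (w + 1).
  move=> [e1 e2 e3 e4]; rewrite /rh /rv !asboolT //.
  have [n [nE [S00 S10 a00]]] := e1.
  have gn00 : gn u w = n by apply: gnE.
  have gn10 : gn (u + 1) w = n.+1 by apply: gnE; lia.
  have gn01 : gn u (w + 1) = n.+1 by apply: gnE; lia.
  have gm10 : gm (u + 1) w = gm u w + 3 by rewrite /gm; ring.
  have gm01 : gm u (w + 1) = gm u w - 3 by rewrite /gm; ring.
  have := rhE _ _ e2; have := rvE _ _ e3; have := rvE _ _ e4.
  rewrite gn00 gn10 gn01 gm10 gm01 addrK subrK => -[_ S11] [_ S01] _.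
  move: S00 S10 a00; rewrite -/(gm u w); move: (gm u w) S11 S01 => m S11 S01 S00 S10 _.
  case: n S00 S01 S10 S11 {nE gn00 gn10 gn01} => [|n] S00; first by have := S_pos V_K S00.
  move=> S01 S10 S11.
  have up := square_ab V_gK V_K V_coef S00 S11; rewrite !asboolT // !mul1r in up.
  have down := square_cd V_gK V_K V_coef S11 S00; rewrite !asboolT // !mul1r in down.
  have a00 : a n.+1 m != 0 by rewrite (mul_lt0_neq0 (ad_lt0 S00 S10)).
  have b00 : b n.+1 m != 0 by rewrite (mul_lt0_neq0 (bc_lt0 S00 S01)).
  have a01 : a n.+2 (m - 3) != 0.
    by have := @ad_lt0 n.+2 (m - 3); rewrite subrK => /(_ S01 S11)/mul_lt0_neq0 ->.
  have b10 : b n.+2 (m + 3) != 0.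
    by have := @bc_lt0 n.+2 (m + 3); rewrite addrK => /(_ S10 S11)/mul_lt0_neq0 ->.
  rewrite !mulf_div up; congr (_ / _).
  by rewrite !mulrNN -!rmorphM [in LHS]mulrC down mulrC.
have [p [p_gt0 pv ph]] := grid_potential rh_gt0 rv_gt0 cocycle.
(* From n - n0 = u + w and m - m0 = 3 (u - w), the grid coordinates of a K-type
   are recovered by exact division. *)
pose cu (n : nat) (m : int) : int := ((3 * (n%:Z - n0%:Z) + (m - m0)) %/ 6)%Z.
pose cw (n : nat) (m : int) : int := ((3 * (n%:Z - n0%:Z) - (m - m0)) %/ 6)%Z.
have cuE (n : nat) m u w : n%:Z = n0%:Z + u + w -> m = gm u w -> cu n m = u.
  move=> nE ->; rewrite /cu /gm nE (_ : _ + _ = u * 6); last by ring.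
  by rewrite mulzK.
have cwE (n : nat) m u w : n%:Z = n0%:Z + u + w -> m = gm u w -> cw n m = w.
  move=> nE ->; rewrite /cw /gm nE (_ : _ - _ = w * 6); last by ring.
  by rewrite mulzK.
have reached := grid_reached_all V_gK V_irr V_K V_coef ad_sym bc_sym S0.
exists (fun n m => p (cu n m) (cw n m)); split.
- by move=> n m; apply: p_gt0.
- move=> n m Snm Snm'; have [u [w [nE mE r]]] := reached _ _ Snm.
  have [u' [w' [nE' mE' r']]] := reached _ _ Snm'.
  have [uu ww] : u' = u + 1 /\ w' = w by lia.
  rewrite (cuE _ _ _ _ nE mE) (cwE _ _ _ _ nE mE) (cuE _ _ _ _ nE' mE') (cwE _ _ _ _ nE' mE').
  rewrite uu ww in r' *.
  have a0 : a n m != 0 by rewrite (mul_lt0_neq0 (ad_lt0 Snm Snm')).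
  have e : Eh u w by exists n; rewrite -mE.
  rewrite ph // /rh asboolT // (gnE _ _ _ nE) /gm -mE; field.
  by rewrite a0.
- move=> n m Snm Snm'; have [u [w [nE mE r]]] := reached _ _ Snm.
  have [u' [w' [nE' mE' r']]] := reached _ _ Snm'.
  have [uu ww] : u' = u /\ w' = w + 1 by lia.
  rewrite (cuE _ _ _ _ nE mE) (cwE _ _ _ _ nE mE) (cuE _ _ _ _ nE' mE') (cwE _ _ _ _ nE' mE').
  rewrite uu ww in r' *.
  have b0 : b n m != 0 by rewrite (mul_lt0_neq0 (bc_lt0 Snm Snm')).
  have e : Ev u w by exists n; rewrite -mE.
  rewrite pv // /rv asboolT // (gnE _ _ _ nE) /gm -mE; field.
  by rewrite b0.
Qed.

End NormPotential.

(** * Invariant Hermitian forms *)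
Section Invariance.
Variables (R : realType) (V : lmodType R[i]).
Local Notation C := R[i].
Variables (pi rho : 'M[C]_3 -> {linear V -> V}).
Hypothesis V_gK : gK_module pi rho.

Definition tau_adjoint (B : V -> V -> C) :=
  forall X x y, sl3 X -> B (pi X x) y = B x (pi (tau X) y).

(** Adjointness is symmetric, so X_alpha, X_beta and X_{alpha+beta} account for
    the generators Y_alpha, Y_beta and Y_{alpha+beta}. *)
Lemma tau_adjoint_gen B : hermitian_form B ->
  (forall x y, B (pi (@H_alpha R) x) y = B x (pi (@H_alpha R) y)) ->
  (forall x y, B (pi (@Z_k R) x) y = B x (pi (@Z_k R) y)) ->
  (forall x y, B (pi (@X_alpha R) x) y = B x (pi (@Y_alpha R) y)) ->
  (forall x y, B (pi (@X_beta R) x) y = - B x (pi (@Y_beta R) y)) ->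
  (forall x y, B (pi (@X_alphabeta R) x) y = - B x (pi (@Y_alphabeta R) y)) ->
  tau_adjoint B.
Proof.
move=> hB bH bZ bXa bXb bXab X x y sX; move: X sX x y.
apply: sl3_ind.
- move=> t X Y sX sY bX bY x y.
  have sX' := sl3_tau sX; have sY' := sl3_tau sY.
  by rewrite tau_linear !(pi_linear V_gK) // (hermZDl hB) (hermZDr hB) bX bY conjCK.
- by move=> x y; rewrite tau_Ha.
- by move=> x y; rewrite tau_Z.
- by move=> x y; rewrite tau_Xa.
- by move=> x y; rewrite tau_Xb (piN V_gK) ?(hermNr hB) //; apply: sl3_Yb.
- by move=> x y; rewrite tau_Xab (piN V_gK) ?(hermNr hB) //; apply: sl3_Yab.
- by move=> x y; rewrite tau_Ya; apply: (adjoint_sym hB).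
- move=> x y; rewrite tau_Yb (piN V_gK) ?(hermNr hB) //; last exact: sl3_Xb.
  rewrite -(adjoint_sym hB (g := fun y => - pi (@Y_beta R) y)) ?(hermNl hB) ?opprK //
    => x' y'; rewrite bXb (hermNr hB) //.
- move=> x y; rewrite tau_Yab (piN V_gK) ?(hermNr hB) //; last exact: sl3_Xab.
  rewrite -(adjoint_sym hB (g := fun y => - pi (@Y_alphabeta R) y)) ?(hermNl hB) ?opprK //
    => x' y'; rewrite bXab (hermNr hB) //.
Qed.

Lemma tau_adjoint_su21 B : hermitian_form B -> tau_adjoint B ->
  forall X x y, su21 X -> B (pi X x) y = - B x (pi X y).
Proof.
move=> hB tB X x y /su21_skew[sX tX].
by rewrite tB // tX (piN V_gK) // (hermNr hB).
Qed.

(** The basis of su(2,1) consists of i X with X = tau X, or of pairs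
    X - tau X and i (X + tau X), from which adjointness of X is recovered by
    complex linear combination. *)
Lemma su21_tau_adjoint B : hermitian_form B ->
  (forall X x y, su21 X -> B (pi X x) y = - B x (pi X y)) -> tau_adjoint B.
Proof.
move=> hB sB.
have self X x y : sl3 X -> su21 ('i *: X) -> B (pi X x) y = B x (pi X y).
  move=> sX /sB - /(_ x y); rewrite !(piZ V_gK) // (hermZl hB) // (hermZr hB) // conjCi mulNr opprK.
  by apply: mulfI; apply: neq0Ci.
have pair X Y x y : sl3 X -> sl3 Y -> su21 (X - Y) -> su21 ('i *: (X + Y)) ->
    B (pi X x) y = B x (pi Y y).
  move=> sX sY su1 su2.
  have sY' : sl3 (- Y) by rewrite /sl3 /= -scaleN1r mxtraceZ sY mulr0.
  have sXY : sl3 (X + Y) by rewrite /sl3 /= mxtraceD sX sY addr0.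
  have e1 := sB _ x y su1; have e2 := self _ x y sXY su2; move: e1 e2.
  rewrite !(piD V_gK) // !(piN V_gK) // !(hermDl hB) // !(hermDr hB) // (hermNl hB) // (hermNr hB) //.
  move: (B (pi X x) y) (B (pi Y x) y) (B x (pi X y)) (B x (pi Y y)) => p q r s e1 e2.
  apply: (mulfI (_ : 2 != 0)); first by rewrite pnatr_eq0.
  have -> : 2 * p = (p - q) + (p + q) by ring.
  by rewrite e1 e2; ring.
have pairN X Y x y : sl3 X -> sl3 Y -> su21 (X + Y) -> su21 ('i *: (X - Y)) ->
    B (pi X x) y = - B x (pi Y y).
  move=> sX sY su1 su2.
  have sY' : sl3 (- Y) by rewrite /sl3 /= -scaleN1r mxtraceZ sY mulr0.
  by rewrite -(hermNr hB) -(piN V_gK) //; apply: pair => //; rewrite opprK.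
have mem j (hj : (j < 8)%N) : su21 (su21_basis R)`_j := su21_basis_mem R (Ordinal hj).
have sHa := sl3_Ha R; have sHb := sl3_Hb R.
have bHa x y : B (pi (@H_alpha R) x) y = B x (pi (@H_alpha R) y).
  exact: (self _ _ _ sHa (mem 0%N isT)).
have bHb x y : B (pi (@H_beta R) x) y = B x (pi (@H_beta R) y).
  exact: (self _ _ _ sHb (mem 1%N isT)).
apply: tau_adjoint_gen => // x y.
- have s2 : sl3 (2 *: @H_beta R) by rewrite /sl3 /= mxtraceZ sHb mulr0.
  rewrite /Z_k !(piD V_gK _ sHa s2) !(piZ V_gK _ _ sHb) (hermDl hB) (hermDr hB) bHa.
  by rewrite (hermZl hB) (hermZr hB) bHb conjC_nat.
- exact: (pair _ _ _ _ (sl3_Xa R) (sl3_Ya R) (mem 2%N isT) (mem 3%N isT)).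
- exact: (pairN _ _ _ _ (sl3_Xb R) (sl3_Yb R) (mem 4%N isT) (mem 5%N isT)).
- exact: (pairN _ _ _ _ (sl3_Xab R) (sl3_Yab R) (mem 6%N isT) (mem 7%N isT)).
Qed.

(** Conjugation by K commutes with tau. *)
Lemma tau_adjoint_rho B k : Kgrp k -> tau_adjoint B ->
  tau_adjoint (fun x y => B (rho k x) (rho k y)).
Proof.
move=> Kk tB X x y sX /=.
rewrite !(gK_Ad V_gK) //; last exact: sl3_tau.
by rewrite tB ?tau_conj //; apply: sl3_conj => //; apply: Kgrp_unit.
Qed.

Lemma hermitian_form_comp B (f : {linear V -> V}) : hermitian_form B ->
  hermitian_form (fun x y => B (f x) (f y)).
Proof.
move=> hB; split=> [y t x x'|x y]; first by rewrite linearP (hermZDl hB).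
by rewrite (herm_conj hB).
Qed.

Variables (S : set (nat * int)) (v : nat -> int -> nat -> V).
Hypothesis V_K : Ktype_decomposition pi S v.

Section Orthogonality.
Variable B : V -> V -> C.
Hypothesis hB : hermitian_form B.
Hypothesis tB : tau_adjoint B.

(** The operator of H_alpha is self-adjoint and its eigenvalues on V_nm are real
    and distinct. *)
Lemma Ktype_weight_orth n m k k' : S (n, m) -> (1 <= k <= n)%N -> (1 <= k' <= n)%N ->
  k != k' -> B (v n m k) (v n m k') = 0.
Proof.
move=> Snm hk hk' kk'; have := tB (v n m k) (v n m k') (sl3_Ha R).
rewrite tau_Ha !(kt_H V_K) // (hermZl hB) (hermZr hB).
rewrite !(rmorphB, rmorphD, rmorphM, rmorph1, conjC_nat) => /eqP.
rewrite -subr_eq0 -mulrBl mulf_eq0 => /orP[|/eqP //].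
rewrite (_ : _ - _ = 2 * (k'%:R - k%:R)); last by ring.
by rewrite mulf_eq0 pnatr_eq0 /= subr_eq0 eqr_nat eq_sym (negPf kk').
Qed.

(** X_alpha and Y_alpha are adjoint. *)
Lemma Ktype_norm_step n m k : S (n, m) -> (0 < k < n)%N ->
  k%:R * B (v n m k) (v n m k) = (n%:R - k%:R) * B (v n m k.+1) (v n m k.+1).
Proof.
move=> Snm /andP[k0 kn]; have := tB (v n m k.+1) (v n m k) (sl3_Xa R).
have hk : (1 <= k <= n)%N by rewrite k0 ltnW.
have hk1 : (1 <= k.+1 <= n)%N by [].
rewrite tau_Xa (kt_X V_K Snm hk1) (kt_Y V_K Snm hk) (hermZl hB) (hermZr hB).
have -> : (- (n%:R - k%:R) : C)^* = - (n%:R - k%:R) by rewrite rmorphN rmorphB /= !conjC_nat.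
by rewrite natr_pred !mulNr => /oppr_inj.
Qed.

Lemma Ktype_norm n m k : S (n, m) -> (1 <= k <= n)%N ->
  'C(n.-1, k.-1)%:R * B (v n m k) (v n m k) = B (v n m 1) (v n m 1).
Proof.
move=> Snm; elim: k => [//|[|k] IHk] hk; first by rewrite bin0 mul1r.
have hk' : (1 <= k.+1 <= n)%N by rewrite /= ltnW.
rewrite -(IHk hk') /=.
have step := Ktype_norm_step Snm (k := k.+1) hk.
have := mul_bin_left n.-1 k; move/(congr1 (fun x => x%:R : C)).
rewrite !natrM natrB; last by rewrite -ltnS prednK ?(S_pos V_K Snm) // ltnW.
have -> : n.-1%:R - k%:R = n%:R - k.+1%:R :> C.
  by rewrite -natr1 -[X in _ = X%:R - _](prednK (S_pos V_K Snm)) -natr1; ring.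
move=> binE; apply: (mulfI (_ : k.+1%:R != 0)); first by rewrite pnatr_eq0.
by rewrite mulrA binE [RHS]mulrCA step; ring.
Qed.

(** The vector v_{n+2,m}^2 is a multiple of Y_alpha v_{n+2,m}^1, and X_alpha, the
    adjoint of Y_alpha, kills v_nm^1.  This removes the second term in the action
    of Y_{alpha+beta} and X_beta on the first vectors. *)
Lemma highest_weight_orth n m : S (n, m) -> B (v n m 1) (v n.+2 m 2) = 0.
Proof.
move=> Snm; have [S2|nS2] := pselect (S (n.+2, m)); last first.
  have -> : v n.+2 m 2 = 0 by apply: (v_out V_K).
  exact: herm0r.
have := tB (v n m 1) (v n.+2 m 1) (sl3_Xa R).
have h1 : (1 <= 1 <= n)%N by exact: (S_pos V_K Snm).
rewrite tau_Xa (kt_X V_K Snm h1) subrr oppr0 scale0r (herm0l hB).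
rewrite (kt_Y V_K S2 (isT : 1 <= 1 <= n.+2)%N) (hermZr hB) => /eqP; rewrite eq_sym mulf_eq0 => /orP[|/eqP //].
by rewrite conjC_eq0 oppr_eq0 natr_pred pnatr_eq0.
Qed.

(** X_{alpha+beta} and - Y_{alpha+beta} are adjoint. *)
Lemma Ktype_edge_ad a b c d : action_coefficients pi S v a b c d ->
  forall n m, S (n, m) -> S (n.+1, m + 3) ->
  a n m * B (v n.+1 (m + 3) 1) (v n.+1 (m + 3) 1) =
  - (d n.+1 (m + 3))^* * B (v n m 1) (v n m 1).
Proof.
move=> V_coef n m S0 S1; have := tB (v n m 1) (v n.+1 (m + 3) 1) (sl3_Xab R).
rewrite tau_Xab (piN V_gK); last exact: sl3_Yab.
rewrite (Xab_v1 V_K V_coef) (Yab_v1 V_K V_coef) !asboolT // !mul1r addrK.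
rewrite (hermZl hB) (hermNr hB) (hermDr hB) !(hermZr hB) highest_weight_orth //.
by rewrite mulr0 add0r mulNr.
Qed.

(** Y_beta and - X_beta are adjoint. *)
Lemma Ktype_edge_bc a b c d : action_coefficients pi S v a b c d ->
  forall n m, S (n, m) -> S (n.+1, m - 3) ->
  b n m * B (v n.+1 (m - 3) 1) (v n.+1 (m - 3) 1) =
  - (c n.+1 (m - 3))^* * B (v n m 1) (v n m 1).
Proof.
move=> V_coef n m S0 S1; have := tB (v n m 1) (v n.+1 (m - 3) 1) (sl3_Yb R).
rewrite tau_Yb (piN V_gK); last exact: sl3_Xb.
rewrite (Yb_v1 V_K V_coef) (Xb_v1 V_K V_coef) !asboolT // !mul1r subrK.
rewrite (hermZl hB) (hermNr hB) (hermDr hB) !(hermZr hB) highest_weight_orth //.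
by rewrite mulr0 add0r mulNr.
Qed.

End Orthogonality.
End Invariance.

(** * Invariance under K *)

(** Bernoulli's inequality. *)
Lemma bernoulli (R : realDomainType) (x : R) j : 0 <= x -> 1 + x *+ j <= (1 + x) ^+ j.
Proof.
move=> x0; elim: j => [|j IHj]; first by rewrite expr0 mulr0n addr0.
rewrite exprSr; apply: le_trans (ler_wpM2r _ IHj); last by rewrite addr_ge0.
have -> : (1 + x *+ j) * (1 + x) = 1 + x *+ j.+1 + x *+ j * x by rewrite mulrSr; ring.
by rewrite lerDl mulr_ge0 ?mulrn_wge0.
Qed.

Lemma bounded_powers_le1 (R : realType) (l M : R[i]) :
  0 <= l -> (forall j, l ^+ j <= M) -> l <= 1.
Proof.
move=> l0 lM.
have toR (z : R[i]) : 0 <= z -> z = (complex.Re z)%:C%C.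
  by case: z => x y; rewrite lecE /= => /andP[/eqP -> _].
have M0 : 0 <= M by apply: le_trans (lM 0%N); rewrite expr0.
move: l0 lM; rewrite (toR _ M0); move/[dup] => /toR ->; set x := complex.Re l.
set K := complex.Re M; rewrite -[0]/(0%:C%C) lecR => x0 xM.
have {}xM j : x ^+ j <= K by have := xM j; rewrite -rmorphXn lecR.
rewrite -[1]/(1%:C%C) lecR leNgt; apply/negP => x1.
have e0 : 0 < x - 1 by rewrite subr_gt0.
have := xM (Num.truncn (K / (x - 1))).+1; apply/negP; rewrite -ltNge.
apply: lt_le_trans (_ : (x - 1) *+ (Num.truncn (K / (x - 1))).+1 <= _).
  by rewrite -mulr_natl -ltr_pdivrMr // truncnS_gt.
have := bernoulli (Num.truncn (K / (x - 1))).+1 (ltW e0).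
by rewrite [1 + (x - 1)]addrC subrK; apply: le_trans; rewrite lerDr.
Qed.

Section KInvariance.
Variables (R : realType) (V : lmodType R[i]).
Local Notation C := R[i].
Variables (pi rho : 'M[C]_3 -> {linear V -> V}).
Hypothesis V_gK : gK_module pi rho.
Variables (S : set (nat * int)) (v : nat -> int -> nat -> V).
Hypothesis V_K : Ktype_decomposition pi S v.

Definition in_Ktype n m x := forall q, kcoord V_K q x != 0 -> q.1 = (n, m).

(** Both forms are diagonal on V_nm, and the binomial coefficients determine
    their diagonals up to a scalar. *)
Lemma Ktype_forms_proportional B B' n m : S (n, m) ->
  hermitian_form B -> tau_adjoint pi B -> hermitian_form B' -> tau_adjoint pi B' ->
  forall x y, in_Ktype n m x -> in_Ktype n m y ->
  B' x y * B (v n m 1) (v n m 1) = B' (v n m 1) (v n m 1) * B x y.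
Proof.
move=> Snm hB tB hB' tB' x y Ux Uy.
apply: (@Kbasis_ind _ _ _ _ _ V_K (fun x => B' x y * _ = _ * B x y) x).
- by rewrite (herm0l hB) (herm0l hB') mul0r mulr0.
- by move=> t z z' e e'; rewrite (hermZDl hB) (hermZDl hB') mulrDl mulrDr -mulrA e e'; ring.
move=> [[n1 m1] k] vp /Ux /= [? ?]; subst n1 m1; case: vp => /= _ hk.
apply: (@Kbasis_ind _ _ _ _ _ V_K (fun y => B' _ y * _ = _ * B _ y) y).
- by rewrite (herm0r hB) (herm0r hB') mul0r mulr0.
- by move=> t z z' e e'; rewrite (hermZDr hB) (hermZDr hB') mulrDl mulrDr -mulrA e e'; ring.
move=> [[n1 m1] k'] vp /Uy /= [? ?]; subst n1 m1; case: vp => /= _ hk'.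
rewrite /Kbasis /=; have [<-|kk'] := eqVneq k k'; last first.
  rewrite (Ktype_weight_orth V_K hB tB Snm hk hk' kk').
  by rewrite (Ktype_weight_orth V_K hB' tB' Snm hk hk' kk') mul0r mulr0.
rewrite -(Ktype_norm V_K hB tB Snm hk) -(Ktype_norm V_K hB' tB' Snm hk); ring.
Qed.

Lemma in_Ktype_v n m : S (n, m) -> in_Ktype n m (v n m 1).
Proof.
move=> Snm q; rewrite (kcoord_basis V_K q (p := (n, m, 1%N))).
  by case: (q =P _) => [-> //|_]; rewrite eqxx.
by split=> //; apply: (S_pos V_K Snm).
Qed.

Lemma in_Ktype_rho n m k x : Kgrp k -> in_Ktype n m x -> in_Ktype n m (rho k x).
Proof.
move=> Kk Ux; apply: (@Kbasis_ind _ _ _ _ _ V_K (fun y => in_Ktype n m (rho k y)) x).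
- by move=> q; rewrite !linear0 eqxx.
- move=> t y z Uy Uz q; rewrite linearP /= linearP /=.
  have [e|/Uy //] := eqVneq (kcoord V_K q (rho k y)) 0.
  have [e'|/Uz //] := eqVneq (kcoord V_K q (rho k z)) 0.
  by rewrite e e' mulr0 addr0 eqxx.
by move=> p vp /Ux pE q /(Ktype_rho_stable V_gK Kk vp) ->.
Qed.

(** A continuous function on the compact group K is bounded. *)
Lemma bounded_orbit (phi : {scalar V}) x :
  exists M : C, forall k, Kgrp k -> `|phi (rho k x) : C| <= M.
Proof. exact: (@bounded_on_Kgrp R (fun k => phi (rho k x)) (@gK_continuous _ _ _ _ V_gK x phi)). Qed.

Lemma Ktype_expansion n m x : in_Ktype n m x ->
  x = \sum_(l < n) kcoord V_K (n, m, l.+1) x *: v n m l.+1.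
Proof.
move=> Ux; apply: (@Kbasis_ind _ _ _ _ _ V_K
  (fun y => y = \sum_(l < n) kcoord V_K (n, m, l.+1) y *: v n m l.+1) x).
- by rewrite big1 // => l _; rewrite linear0 scale0r.
- move=> t y z yE zE; rewrite {1}yE {1}zE scaler_sumr -big_split; apply: eq_bigr => l _ /=.
  by rewrite linearP /= scalerDl scalerA.
move=> [[n1 m1] k] vp /Ux /= [? ?]; subst n1 m1; case: (vp) => /= _ /andP[k0 kn].
have kn' : (k.-1 < n)%N by rewrite prednK.
rewrite (bigD1 (Ordinal kn')) //= big1 ?addr0 => [|l lk].
  by rewrite prednK // (kcoord_basis V_K _ vp) eqxx scale1r.
rewrite (kcoord_basis V_K _ vp) (_ : _ == _ = false) ?scale0r //.
apply: contraNF lk => /eqP[lk]; apply/eqP/val_inj => /=.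
by rewrite -lk.
Qed.

Section Form.
Variable B : V -> V -> C.
Hypothesis hB : hermitian_form B.
Hypothesis tB : tau_adjoint pi B.
Hypothesis B_pos : forall x, x != 0 -> 0 < B x x.
Hypothesis B_orth : forall p q, Kindex S p -> Kindex S q -> p.1 <> q.1 ->
  B (Kbasis v p) (Kbasis v q) = 0.

Lemma herm_real x : B x x \is Num.real.
Proof. by apply/CrealP; rewrite -(herm_conj hB). Qed.

(** In coordinates on V_nm the norm is a finite sum of products of two linear
    functionals of the orbit. *)
Lemma bounded_orbit_norm n m : S (n, m) ->
  exists M : C, forall k, Kgrp k -> B (rho k (v n m 1)) (rho k (v n m 1)) <= M.
Proof.
move=> Snm; set x := v n m 1.
have Ux : in_Ktype n m x by apply: in_Ktype_v.
pose coef (l : 'I_n) : {scalar V} := kcoord V_K (n, m, l.+1).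
have pair_linear (z : V) : linear_for *%R (fun y => B y z).
  by move=> t y y'; rewrite (hermZDl hB).
pose pairing (z : V) : {scalar V} :=
  HB.pack (fun y => B y z) (GRing.isLinear.Build C V C *%R _ (pair_linear z)).
have [M1 M1P] := choice (fun l => bounded_orbit (coef l) x).
have [M2 M2P] := choice (fun l : 'I_n => bounded_orbit (pairing (v n m l.+1)) x).
exists (\sum_l M1 l * M2 l) => k Kk; set y := rho k x.
apply: le_trans (real_ler_norm (herm_real y)) _.
have -> : B y y = \sum_(l < n) kcoord V_K (n, m, l.+1) y * B (v n m l.+1) y.
  rewrite [X in B X _](Ktype_expansion (in_Ktype_rho Kk Ux)).
  elim/big_rec2: _ => [|l z t _ <-]; first exact: herm0l.
  by rewrite (hermZDl hB).
apply: le_trans (ler_norm_sum _ _ _) _; apply: ler_sum => l _.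
rewrite normrM ler_pM //; first exact: M1P.
by rewrite (herm_conj hB) norm_conjC; apply: M2P.
Qed.

Lemma herm_ge0 x : 0 <= B x x.
Proof.
have [->|/B_pos/ltW //] := eqVneq x 0; by rewrite (herm0l hB).
Qed.

(** The form transported by k is again Hermitian and tau-adjoint. *)
Lemma K_scaling k n m : Kgrp k -> S (n, m) ->
  exists2 lam : C, 0 <= lam & forall x y, in_Ktype n m x -> in_Ktype n m y ->
    B (rho k x) (rho k y) = lam * B x y.
Proof.
move=> Kk Snm; have vx : Kindex S (n, m, 1%N) by split=> //; apply: (S_pos V_K Snm).
have B0 : 0 < B (v n m 1) (v n m 1) by apply: B_pos; apply: (Kbasis_neq0 V_K vx).
have hB' := hermitian_form_comp (rho k) hB; have tB' := tau_adjoint_rho V_gK Kk tB.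
exists (B (rho k (v n m 1)) (rho k (v n m 1)) / B (v n m 1) (v n m 1)).
  by rewrite divr_ge0 ?herm_ge0.
move=> x y Ux Uy; apply: (mulIf (lt0r_neq0 B0)).
rewrite (Ktype_forms_proportional Snm hB tB hB' tB' Ux Uy).
by rewrite mulrAC divfK ?gt_eqF.
Qed.

Lemma KgrpX (k : 'M[C]_3) j : Kgrp k -> Kgrp (k ^+ j).
Proof.
move=> Kk; elim: j => [|j IHj]; first exact: Kgrp1.
by rewrite exprS; apply: KgrpM.
Qed.

(** The element k^j scales the form by the j-th power of the scalar of k, and
    orbits of K are bounded. *)
Lemma K_scaling_le1 k n m lam : Kgrp k -> S (n, m) -> 0 <= lam ->
  (forall x y, in_Ktype n m x -> in_Ktype n m y ->
    B (rho k x) (rho k y) = lam * B x y) -> lam <= 1.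
Proof.
move=> Kk Snm lam0 lamP; set x0 := v n m 1.
have vx : Kindex S (n, m, 1%N) by split=> //; apply: (S_pos V_K Snm).
have B0 : 0 < B x0 x0 by apply: B_pos; apply: (Kbasis_neq0 V_K vx).
have [M MP] := bounded_orbit_norm Snm.
apply: (@bounded_powers_le1 R lam (M / B x0 x0)) => // j.
rewrite ler_pdivlMr //; apply: le_trans (MP _ (KgrpX j Kk)).
rewrite le_eqVlt; apply/orP; left; apply/eqP; elim: j => [|j IHj].
  by rewrite !expr0 mul1r (gK_1 V_gK).
rewrite exprS -mulrA IHj -lamP; try by apply: in_Ktype_rho (in_Ktype_v Snm); apply: KgrpX.
by rewrite -!(gK_mul V_gK _ Kk (KgrpX j Kk)) [k ^+ j.+1]exprS.
Qed.

(** Distinct K-types are orthogonal and K-stable.  On a single K-type the scalars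
    of k and of its inverse have product 1 and are both at most 1. *)
Lemma K_invariant k x y : Kgrp k -> B (rho k x) (rho k y) = B x y.
Proof.
move=> Kk.
apply: (@Kbasis_ind _ _ _ _ _ V_K (fun x => B (rho k x) (rho k y) = B x y) x).
- by rewrite linear0 !(herm0l hB).
- by move=> t z z' e e'; rewrite linearP !(hermZDl hB) e e'.
move=> p vp _.
apply: (@Kbasis_ind _ _ _ _ _ V_K (fun y => B _ (rho k y) = B _ y) y).
- by rewrite linear0 !(herm0r hB).
- by move=> t z z' e e'; rewrite linearP !(hermZDr hB) e e'.
move=> q vq _; have in_own r : Kindex S r -> in_Ktype r.1.1 r.1.2 (Kbasis v r).
  move=> vr r'; rewrite (kcoord_basis V_K _ vr).
  by case: (r' =P r) => [-> _|_]; rewrite ?eqxx // -surjective_pairing.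
have [pq|pq] := eqVneq p.1 q.1; last first.
  rewrite (B_orth vp vq (elimN eqP pq)).
  have : in_Ktype q.1.1 q.1.2 (rho k (Kbasis v q)) by apply: in_Ktype_rho (in_own _ vq).
  have : in_Ktype p.1.1 p.1.2 (rho k (Kbasis v p)) by apply: in_Ktype_rho (in_own _ vp).
  move: (rho k (Kbasis v p)) (rho k (Kbasis v q)) => z z' Uz Uz'.
  apply: (@Kbasis_ind _ _ _ _ _ V_K (fun z => B z z' = 0) z).
  - by rewrite (herm0l hB).
  - by move=> t y1 y2 e e'; rewrite (hermZDl hB) e e' mulr0 addr0.
  move=> r vr /Uz rp.
  apply: (@Kbasis_ind _ _ _ _ _ V_K (fun z => B _ z = 0) z').
  - by rewrite (herm0r hB).
  - by move=> t y1 y2 e e'; rewrite (hermZDr hB) e e' mulr0 addr0.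
  move=> s vs /Uz' sq; apply: B_orth => //; rewrite rp sq -!surjective_pairing.
  exact: elimN eqP pq.
have Up := in_own p vp; have Uq := in_own q vq; rewrite -pq in Uq.
have Sp : S (p.1.1, p.1.2) by case: vp.
have [lam lam0 lamP] := K_scaling Kk Sp.
have [lam' lam0' lamP'] := K_scaling (KgrpV Kk) Sp.
have lam1 := K_scaling_le1 Kk Sp lam0 lamP.
have lam1' := K_scaling_le1 (KgrpV Kk) Sp lam0' lamP'.
have Bp : 0 < B (Kbasis v p) (Kbasis v p) by apply: B_pos; apply: (Kbasis_neq0 V_K vp).
have rhoK z : rho (invmx k) (rho k z) = z.
  by rewrite -(gK_mul V_gK) ?mulVmx ?Kgrp_unit ?(gK_1 V_gK) //; apply: KgrpV.
have ll : lam' * lam = 1.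
  apply: (mulIf (lt0r_neq0 Bp)); rewrite mul1r -mulrA -lamP //.
  by rewrite -lamP' ?rhoK //; apply: in_Ktype_rho.
rewrite lamP // (_ : lam = 1) ?mul1r //; apply/eqP; rewrite eq_le lam1 /=.
by rewrite -ll ler_piMl.
Qed.

End Form.
End KInvariance.

(** * Unitary modules have negative products *)
Section Necessity.
Variables (R : realType) (V : lmodType R[i]).
Local Notation C := R[i].
Variables (pi rho : 'M[C]_3 -> {linear V -> V}).
Hypothesis V_gK : gK_module pi rho.
Hypothesis V_irr : gK_irreducible pi rho.
Variables (S : set (nat * int)) (v : nat -> int -> nat -> V).
Hypothesis V_K : Ktype_decomposition pi S v.
Variables a b c d : nat -> int -> C.
Hypothesis V_coef : action_coefficients pi S v a b c d.

Lemma mul_lt0_of_norms (x y N N' : C) : 0 < N -> 0 < N' -> x * N' = - y^* * N ->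
  x != 0 -> x * y < 0.
Proof.
move=> N0 N0' e x0.
have y0 : y != 0.
  by apply: contraNneq x0 => y0; move/eqP: e; rewrite y0 conjC0 oppr0 mul0r mulf_eq0 (gt_eqF N0') orbF.
have xE : x = - y^* * N / N' by rewrite -e mulfK // gt_eqF.
have -> : x * y = - ((y * y^*) * (N / N')) by rewrite xE; ring.
by rewrite oppr_lt0 mulr_gt0 ?divr_gt0 // mul_conjC_gt0.
Qed.

Lemma neq0_of_norms (x y N N' : C) : 0 < N -> 0 < N' -> x * N' = - y^* * N ->
  (x != 0) = (y != 0).
Proof.
move=> N0 N0' e; congr negb; apply/eqP/eqP => h; move/eqP: e; rewrite h.
  by rewrite mul0r eq_sym mulf_eq0 (gt_eqF N0) orbF oppr_eq0 conjC_eq0 => /eqP.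
by rewrite conjC0 oppr0 mul0r mulf_eq0 (gt_eqF N0') orbF => /eqP.
Qed.

Lemma unitary_signs : gK_unitary pi rho ->
  (forall n m, S (n, m) -> S (n.+1, m + 3) -> a n m * d n.+1 (m + 3) < 0) /\
  (forall n m, S (n, m) -> S (n.+1, m - 3) -> b n m * c n.+1 (m - 3) < 0).
Proof.
move=> [ip [ip_su21 _]]; pose B x y := ip x y.
have hB : hermitian_form B := dot_hermitian ip.
have tB : tau_adjoint pi B := su21_tau_adjoint V_gK hB ip_su21.
pose N n m := B (v n m 1) (v n m 1).
have N_gt0 n m : S (n, m) -> 0 < N n m.
  move=> Snm; apply: neq0_dnorm_gt0; apply: (Kbasis_neq0 V_K (p := (n, m, 1%N))).
  by split=> //; apply: (S_pos V_K Snm).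
have ad := Ktype_edge_ad V_gK V_K hB tB V_coef.
have bc := Ktype_edge_bc V_gK V_K hB tB V_coef.
have ad_sym n m : S (n, m) -> S (n.+1, m + 3) -> (a n m != 0) = (d n.+1 (m + 3) != 0).
  by move=> h h'; apply: neq0_of_norms (ad _ _ h h'); apply: N_gt0.
have bc_sym n m : S (n, m) -> S (n.+1, m - 3) -> (b n m != 0) = (c n.+1 (m - 3) != 0).
  by move=> h h'; apply: neq0_of_norms (bc _ _ h h'); apply: N_gt0.
split=> n m h h'.
  apply: mul_lt0_of_norms (ad _ _ h h') _; try exact: N_gt0.
  exact: (ad_neq0 V_gK V_irr V_K V_coef ad_sym bc_sym).
apply: mul_lt0_of_norms (bc _ _ h h') _; try exact: N_gt0.
exact: (bc_neq0 V_gK V_irr V_K V_coef ad_sym bc_sym).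
Qed.

End Necessity.

(** * Negative products give a unitary module *)
Section Sufficiency.
Variables (R : realType) (V : lmodType R[i]).
Local Notation C := R[i].
Variables (pi rho : 'M[C]_3 -> {linear V -> V}).
Hypothesis V_gK : gK_module pi rho.
Hypothesis V_irr : gK_irreducible pi rho.
Variables (S : set (nat * int)) (v : nat -> int -> nat -> V).
Hypothesis V_K : Ktype_decomposition pi S v.
Variables a b c d : nat -> int -> C.
Hypothesis V_coef : action_coefficients pi S v a b c d.

Lemma adjoint_on_basis (B : V -> V -> C) (f : {linear V -> V}) (g : V -> V) :
  hermitian_form B -> (forall t x y, g (t *: x + y) = t *: g x + g y) ->
  (forall p q, Kindex S p -> Kindex S q ->
     B (f (Kbasis v p)) (Kbasis v q) = B (Kbasis v p) (g (Kbasis v q))) ->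
  forall x y, B (f x) y = B x (g y).
Proof.
move=> hB glin fg x y.
have g0 : g 0 = 0 by have := glin (-1) 0 0; rewrite scaler0 addr0 scaleN1r addNr.
apply: (@Kbasis_ind _ _ _ _ _ V_K (fun x => B (f x) y = B x (g y)) x).
- by rewrite linear0 !(herm0l hB).
- by move=> t z z' e e'; rewrite linearP !(hermZDl hB) e e'.
move=> p vp _; apply: (@Kbasis_ind _ _ _ _ _ V_K (fun y => B _ y = B _ (g y)) y).
- by rewrite g0 !(herm0r hB).
- by move=> t z z' e e'; rewrite glin !(hermZDr hB) e e'.
by move=> q vq _; apply: fg.
Qed.

(** A base point for the norms. *)
Lemma Ktype_exists : exists n m, S (n, m).
Proof.
apply: contrapT => noS; have [[x /eqP x0] _] := V_irr; apply: x0.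
apply: (@Kbasis_ind _ _ _ _ _ V_K (fun x => x = 0) x) => //.
- by move=> t y z -> ->; rewrite scaler0 addr0.
- by move=> p [Sp _]; case: noS; exists p.1.1, p.1.2.
Qed.

Section InnerProduct.
Variable N0 : nat -> int -> C.
Hypothesis N0_gt0 : forall n m, 0 < N0 n m.
Hypothesis N0_ad : forall n m, S (n, m) -> S (n.+1, m + 3) ->
  a n m * N0 n.+1 (m + 3) = - (d n.+1 (m + 3))^* * N0 n m.
Hypothesis N0_bc : forall n m, S (n, m) -> S (n.+1, m - 3) ->
  b n m * N0 n.+1 (m - 3) = - (c n.+1 (m - 3))^* * N0 n m.

(** The norm of v_nm^k that Ktype_norm forces.  The value 1 at the remaining
    indices, where the basis vector is 0, makes the weight positive everywhere. *)
Definition weight (p : nat * int * nat) : C :=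
  if `[< Kindex S p >] then N0 p.1.1 p.1.2 / 'C(p.1.1.-1, p.2.-1)%:R else 1.

Lemma weightE n m k : S (n, m) -> (1 <= k <= n)%N -> weight (n, m, k) = N0 n m / 'C(n.-1, k.-1)%:R.
Proof. by move=> h h'; rewrite /weight asboolT. Qed.

Lemma bin_gt0_Kindex n k : (1 <= k <= n)%N -> (0 < 'C(n.-1, k.-1))%N.
Proof. by case: n k => [|n] [|k] //= h; rewrite bin_gt0. Qed.

Lemma weight_gt0 p : 0 < weight p.
Proof.
rewrite /weight; case: asboolP => // -[_ hk].
by rewrite divr_gt0 // ltr0n bin_gt0_Kindex.
Qed.

Definition Kform : V -> V -> C := diag_form (Kbasis_out V_K) (kt_span V_K) weight.

Lemma Kform_hermitian : hermitian_form Kform.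
Proof.
split=> [y t x x'|x y]; first by apply: diag_form_linear; apply: (kt_free V_K).
exact: (diag_form_herm (Kbasis_out V_K) (kt_span V_K) (kt_free V_K) weight_gt0).
Qed.

Lemma Kform_pos x : x != 0 -> 0 < Kform x x.
Proof. exact: (diag_form_pos (Kbasis_out V_K) (kt_span V_K) weight_gt0). Qed.

Lemma Kform_basis p q : Kindex S p -> Kindex S q ->
  Kform (Kbasis v p) (Kbasis v q) = weight p * (p == q)%:R.
Proof. by apply: diag_form_e; apply: (kt_free V_K). Qed.

Lemma Kform_vl n m k q : Kindex S q ->
  Kform (v n m k) (Kbasis v q) = weight q * ((n, m, k) == q)%:R.
Proof.
move=> vq; have [vp|nvp] := pselect (Kindex S (n, m, k)).
  by rewrite (Kform_basis vp vq); case: eqP => [->|]; rewrite ?mulr0.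
rewrite (Kbasis_out V_K nvp : v n m k = 0) (herm0l Kform_hermitian).
by case: eqP => [E|_]; rewrite ?mulr0 //; case: nvp; rewrite E.
Qed.

Lemma Kform_vr n m k p : Kindex S p ->
  Kform (Kbasis v p) (v n m k) = weight p * (p == (n, m, k))%:R.
Proof.
move=> vp; have [vq|nvq] := pselect (Kindex S (n, m, k)); first exact: (Kform_basis vp vq).
rewrite (Kbasis_out V_K nvq : v n m k = 0) (herm0r Kform_hermitian).
by case: eqP => [E|_]; rewrite ?mulr0 //; case: nvq; rewrite -E.
Qed.

Let hB := Kform_hermitian.

Lemma Kform_adjoint_Xa p q : Kindex S p -> Kindex S q ->
  Kform (pi (@X_alpha R) (Kbasis v p)) (Kbasis v q) =
  Kform (Kbasis v p) (pi (@Y_alpha R) (Kbasis v q)).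
Proof.
move=> vp vq; rewrite {1}/Kbasis {2}/Kbasis.
have [Sp kp] := vp; have [Sq kq] := vq.
rewrite (kt_X V_K Sp kp) (kt_Y V_K Sq kq) (hermZl hB) (hermZr hB) Kform_vl // Kform_vr //.
case: p vp Sp kp => [[n m] k] vp /= Sp kp; case: q vq Sq kq => [[n' m'] k'] vq /= Sq kq.
case: eqP => [[? ? kE]|neq]; last first.
  rewrite (_ : _ == _ = false) ?mulr0 //; apply/eqP => -[? ? kE]; subst n m k.
  exact: neq.
subst n' m' k'; case: k vp kp vq Sq kq => [//|[//|k]] vp kp vq Sq kq.
rewrite eqxx !mulr1 !weightE //=.
have -> : (- (n%:R - k.+1%:R) : C)^* = - (n%:R - k.+1%:R) by rewrite rmorphN rmorphB /= !conjC_nat.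
have := mul_bin_left n.-1 k; move/(congr1 (fun x => x%:R : C)).
have n0 : (0 < n)%N by lia.
rewrite !natrM natrB; last by lia.
have -> : n.-1%:R - k%:R = n%:R - k.+1%:R :> C.
  by rewrite -[k.+1%:R]natr1 -[X in _ = X%:R - _](prednK n0) -[n.-1.+1%:R]natr1; ring.
have b1 : 'C(n.-1, k)%:R != 0 :> C by rewrite pnatr_eq0 -lt0n bin_gt0; lia.
have b2 : 'C(n.-1, k.+1)%:R != 0 :> C by rewrite pnatr_eq0 -lt0n bin_gt0; lia.
rewrite natr_pred => binE; apply: (mulIf b2); apply: (mulIf b1).
transitivity (- (k.+1%:R * 'C(n.-1, k.+1)%:R) * N0 n m); first by field.
by rewrite binE; field.
Qed.

Lemma weight_conj p : (weight p)^* = weight p.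
Proof. by apply/CrealP/gtr0_real/weight_gt0. Qed.

(** Along an edge with coefficient x upwards and y downwards, the relation
    between the norms of the first vectors extends to all vectors: the quotient of
    the binomial coefficients is the fraction in the action of sl(3,C).  The edge
    joins v_nm^k to v_{n+1,m'}^k or to v_{n+1,m'}^{k+1}. *)
Section Edge.
Variables (n : nat) (m m' : int) (x y : C).
Hypotheses (Snm : S (n, m)) (Snm' : S (n.+1, m')).
Hypothesis xy : x * N0 n.+1 m' = - y^* * N0 n m.

Lemma weight_edge_low k : (1 <= k <= n)%N ->
  x * weight (n.+1, m', k) = - ((n.+1%:R - k%:R) / n%:R * y^*) * weight (n, m, k).
Proof.
move=> hk; have hk' : (1 <= k <= n.+1)%N by lia.
rewrite (weightE Snm' hk') (weightE Snm hk) /=.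
case: k hk hk' => [//|k] hk hk' /=.
have n0 : n%:R != 0 :> C by rewrite pnatr_eq0; lia.
have b1 : 'C(n, k)%:R != 0 :> C by rewrite pnatr_eq0 -lt0n bin_gt0; lia.
have b2 : 'C(n.-1, k)%:R != 0 :> C by rewrite pnatr_eq0 -lt0n bin_gt0; lia.
have := mul_bin_down n k; move/(congr1 (fun x => x%:R : C)); rewrite !natrM natrB; last by lia.
have -> : n.+1%:R - k.+1%:R = n%:R - k%:R :> C by rewrite -[n.+1%:R]natr1 -[k.+1%:R]natr1; ring.
move=> binE; apply: (mulIf b1); apply: (mulIf b2); apply: (mulIf n0).
transitivity (x * N0 n.+1 m' * (n%:R * 'C(n.-1, k)%:R)); first by field.
by rewrite xy binE; field; rewrite ?n0 ?b1 ?b2.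
Qed.

Lemma weight_edge_high k : (1 <= k <= n)%N ->
  x * weight (n.+1, m', k.+1) = - (k%:R / n%:R * y^*) * weight (n, m, k).
Proof.
move=> hk; have hk' : (1 <= k.+1 <= n.+1)%N by lia.
rewrite (weightE Snm' hk') (weightE Snm hk) /=.
case: k hk hk' => [//|k] hk hk' /=.
have n0 : n%:R != 0 :> C by rewrite pnatr_eq0; lia.
have b1 : 'C(n, k.+1)%:R != 0 :> C by rewrite pnatr_eq0 -lt0n bin_gt0; lia.
have b2 : 'C(n.-1, k)%:R != 0 :> C by rewrite pnatr_eq0 -lt0n bin_gt0; lia.
have := mul_bin_diag n k; move/(congr1 (fun x => x%:R : C)); rewrite !natrM => binE.
apply: (mulIf b1); apply: (mulIf b2); apply: (mulIf n0).
transitivity (x * N0 n.+1 m' * (n%:R * 'C(n.-1, k)%:R)); first by field.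
by rewrite xy binE; field; rewrite ?n0 ?b1 ?b2.
Qed.

Lemma conj_ratio (r s : nat) : ((s%:R - r%:R) / n%:R : C)^* = (s%:R - r%:R) / n%:R.
Proof. by rewrite rmorphM fmorphV rmorphB /= !conjC_nat. Qed.

Lemma weight_edge_low_conj k : (1 <= k <= n)%N ->
  x^* * weight (n.+1, m', k) = - ((n.+1%:R - k%:R) / n%:R * y) * weight (n, m, k).
Proof.
move=> hk; have := congr1 Num.conj (weight_edge_low hk).
rewrite /= rmorphM /= weight_conj => ->.
by rewrite rmorphM /= weight_conj rmorphN rmorphM /= conjCK conj_ratio.
Qed.

Lemma weight_edge_high_conj k : (1 <= k <= n)%N ->
  x^* * weight (n.+1, m', k.+1) = - (k%:R / n%:R * y) * weight (n, m, k).
Proof.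
move=> hk; have := congr1 Num.conj (weight_edge_high hk).
rewrite /= rmorphM /= weight_conj => ->.
rewrite rmorphM /= weight_conj rmorphN rmorphM /= conjCK.
by rewrite rmorphM fmorphV /= !conjC_nat.
Qed.
End Edge.

(** Both sides vanish unless q arises from p by one of the two terms of
    X_{alpha+beta}, or equivalently p from q by the corresponding term of
    Y_{alpha+beta}.  The term with a uses the edge upwards from p, the term with c
    the edge upwards from q. *)
Lemma Kform_adjoint_Xab p q : Kindex S p -> Kindex S q ->
  Kform (pi (@X_alphabeta R) (Kbasis v p)) (Kbasis v q) =
  Kform (Kbasis v p) (- pi (@Y_alphabeta R) (Kbasis v q)).
Proof.
move=> vp vq; rewrite {1}/Kbasis {2}/Kbasis.
have [Sp kp] := vp; have [Sq kq] := vq.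
rewrite (ac_Xab V_coef Sp kp) (ac_Yab V_coef Sq kq) (hermNr hB) (hermDl hB) (hermDr hB).
rewrite !(hermZl hB) !(hermZr hB) !Kform_vl // !Kform_vr //.
case: p vp Sp kp => [[n m] k] vp /= Sp kp; case: q vq Sq kq => [[n' m'] k'] vq /= Sq kq.
have E1 : ((n, m, k) == (n'.-1, m' - 3, k')) = ((n.+1, m + 3, k) == (n', m', k')).
  by apply/eqP/eqP => -[*]; congr (_, _, _); lia.
have E2 : ((n, m, k) == (n'.+1, m' - 3, k'.+1)) = ((n.-1, m + 3, k.-1) == (n', m', k')).
  by apply/eqP/eqP => -[*]; congr (_, _, _); lia.
rewrite E1 E2; have [[? ? ?]|_] := eqVneq (n.+1, m + 3, k) (n', m', k').
  subst n' m' k'; rewrite (_ : _ == _ = false) ?mulr0; last by apply/eqP => -[]; lia.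
  rewrite addr0 add0r !mulr1 (weight_edge_low Sp Sq (N0_ad Sp Sq) kp) natr_pred.
  by rewrite rmorphM /= conj_ratio mulNr.
have [e|_] := eqVneq (n.-1, m + 3, k.-1) (n', m', k'); last by rewrite !(mulr0, addr0, oppr0).
rewrite e eqxx in E2; move/eqP: E2 => [? ? ?]; subst n m k.
rewrite !mulr0 addr0 add0r !mulr1 (weight_edge_high_conj Sq Sp (N0_bc Sq Sp) kq).
by rewrite !natr_pred mulNr opprK.
Qed.

Lemma Kform_adjoint_Xb p q : Kindex S p -> Kindex S q ->
  Kform (pi (@X_beta R) (Kbasis v p)) (Kbasis v q) =
  Kform (Kbasis v p) (- pi (@Y_beta R) (Kbasis v q)).
Proof.
move=> vp vq; rewrite {1}/Kbasis {2}/Kbasis.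
have [Sp kp] := vp; have [Sq kq] := vq.
rewrite (ac_Xb V_coef Sp kp) (ac_Yb V_coef Sq kq) (hermNr hB) (hermDl hB) (hermDr hB) (hermNr hB).
rewrite !(hermZl hB) !(hermZr hB) !Kform_vl // !Kform_vr //.
case: p vp Sp kp => [[n m] k] vp /= Sp kp; case: q vq Sq kq => [[n' m'] k'] vq /= Sq kq.
have E1 : ((n, m, k) == (n'.-1, m' - 3, k'.-1)) = ((n.+1, m + 3, k.+1) == (n', m', k')).
  by apply/eqP/eqP => -[*]; congr (_, _, _); lia.
have E2 : ((n, m, k) == (n'.+1, m' - 3, k')) = ((n.-1, m + 3, k) == (n', m', k')).
  by apply/eqP/eqP => -[*]; congr (_, _, _); lia.
rewrite E1 E2; have [[? ? ?]|_] := eqVneq (n.+1, m + 3, k.+1) (n', m', k').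
  subst n' m' k'; rewrite (_ : _ == _ = false) ?mulr0; last by apply/eqP => -[]; lia.
  rewrite addr0 add0r !mulr1 !natr_pred mulNr (weight_edge_high Sp Sq (N0_ad Sp Sq) kp).
  by rewrite rmorphM /= rmorphM fmorphV /= !conjC_nat mulNr !opprK.
have [e|_] := eqVneq (n.-1, m + 3, k) (n', m', k'); last by rewrite !(mulr0, addr0, oppr0).
rewrite e eqxx in E2; move/eqP: E2 => [? ? ?]; subst n m k.
rewrite !mulr0 add0r oppr0 addr0 !mulr1 (weight_edge_low_conj Sq Sp (N0_bc Sq Sp) kq).
by rewrite !natr_pred mulNr opprK.
Qed.

Lemma Kform_adjoint_diag X (l : nat * int * nat -> int) :
  (forall p, Kindex S p -> pi X (Kbasis v p) = (l p)%:~R *: Kbasis v p) ->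
  forall p q, Kindex S p -> Kindex S q ->
  Kform (pi X (Kbasis v p)) (Kbasis v q) = Kform (Kbasis v p) (pi X (Kbasis v q)).
Proof.
move=> eig p q vp vq; rewrite !eig // (hermZl hB) (hermZr hB) Kform_basis //.
by rewrite rmorph_int; case: eqP => [->|] //; rewrite !mulr0.
Qed.

Lemma Kform_tau_adjoint : tau_adjoint pi Kform.
Proof.
have opp_linear (f : {linear V -> V}) t x y : - f (t *: x + y) = t *: - f x + - f y.
  by rewrite linearP opprD scalerN.
have adj (f g : {linear V -> V}) := adjoint_on_basis (f := f) hB (fun t x y => linearP g t x y).
have adjN (f g : {linear V -> V}) := adjoint_on_basis (f := f) hB (opp_linear g).
apply: (tau_adjoint_gen V_gK hB).
- apply: adj; apply: (Kform_adjoint_diag (l := fun p => p.1.1%:Z + 1 - 2 * p.2%:Z)) => p [Sp kp].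
  rewrite /Kbasis (kt_H V_K Sp kp); congr (_ *: _).
  by rewrite !(rmorphD, rmorphN, rmorphM, rmorph1).
- apply: adj; apply: (Kform_adjoint_diag (l := fun p => p.1.2)) => p [Sp kp].
  exact: (kt_Z V_K Sp kp).
- by apply: adj; apply: Kform_adjoint_Xa.
- by move=> x y; rewrite -(hermNr hB); apply: adjN; apply: Kform_adjoint_Xb.
- by move=> x y; rewrite -(hermNr hB); apply: adjN; apply: Kform_adjoint_Xab.
Qed.

Lemma Kform_orth p q : Kindex S p -> Kindex S q -> p.1 <> q.1 ->
  Kform (Kbasis v p) (Kbasis v q) = 0.
Proof.
move=> vp vq pq; rewrite Kform_basis //; case: eqP => [e|_]; last exact: mulr0.
by case: pq; rewrite e.
Qed.

Lemma Kform_unitary : gK_unitary pi rho.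
Proof.
have [ip ipE] := exists_dot hB Kform_pos; exists ip.
split=> [X x y sX|k x y Kk]; rewrite !ipE.
  exact: (tau_adjoint_su21 V_gK hB Kform_tau_adjoint).
exact: (K_invariant V_gK V_K hB Kform_tau_adjoint Kform_pos Kform_orth).
Qed.

End InnerProduct.

Lemma signs_unitary :
  (forall n m, S (n, m) -> S (n.+1, m + 3) -> a n m * d n.+1 (m + 3) < 0) ->
  (forall n m, S (n, m) -> S (n.+1, m - 3) -> b n m * c n.+1 (m - 3) < 0) ->
  gK_unitary pi rho.
Proof.
move=> ad_lt0 bc_lt0; have [n0 [m0 S0]] := Ktype_exists.
have [N [N_gt0 N_ad N_bc]] := norms_exist V_gK V_irr V_K V_coef ad_lt0 bc_lt0 S0.
exact: Kform_unitary N_gt0 N_ad N_bc.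
Qed.

End Sufficiency.

(* In the order of R[i], x < 0 means that x is a negative real number. *)
Theorem theorem4 (R : realType) (V : lmodType R[i])
    (pi rho : 'M[R[i]]_3 -> {linear V -> V})
    (V_gK : gK_module pi rho) (V_irr : gK_irreducible pi rho)
    (S : set (nat * int)) (v : nat -> int -> nat -> V)
    (V_K : Ktype_decomposition pi S v)
    (a b c d : nat -> int -> R[i])
    (V_coef : action_coefficients pi S v a b c d) :
  gK_unitary pi rho <->
  (forall (n : nat) (m : int), S (n, m) -> S (n.+1, m + 3) ->
     a n m * d n.+1 (m + 3) < 0) /\
  (forall (n : nat) (m : int), S (n, m) -> S (n.+1, m - 3) ->
     b n m * c n.+1 (m - 3) < 0).
Proof.
split; first exact: unitary_signs V_gK V_irr S v V_K a b c d V_coef.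
by case; apply: signs_unitary V_gK V_irr S v V_K a b c d V_coef.
Qed.
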